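(* Let $T$ be a tree of type $H$ with parameters $(s,t;r;a,b)$. Then $T$ is a path-like tree with a bridge path if and only if one of the following holds: (i) there exist a divisor $d_1$ of $s$, a divisor $d_2$ of $t$ and an integer $\delta$ with $2\le\delta\le\min\{d_1,d_2\}-1$ such that $d_1-\delta=\min\{a-1,s-a\}$, $d_2-\delta=\min\{b-1,t-b\}$ and $\delta$ divides $r-1$; (ii) there exists $\delta\in\{a,s-a+1\}\cap\{b,t-b+1\}$ such that $\delta$ divides $r-1$; (iii) there exist $\delta\in\{a,s-a+1\}$ and a divisor $d_2$ of $t$ such that $d_2-\delta=\min\{b-1,t-b\}$ and $\delta$ divides $r-1$; (iv) there exist $\delta\in\{b,t-b+1\}$ and a divisor $d_1$ of $s$ such that $d_1-\delta=\min\{a-1,s-a\}$ and $\delta$ divides $r-1$.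
   Context: A tree of type $H$ with parameters $(s,t;r;a,b)$, where $r\ge1$, $1<a<s$, $1<b<t$, is the tree with vertex set $\{u_1,\ldots,u_s,v_1,\ldots,v_t,w_1,\ldots,w_{r+1}\}$ in which $u_a=w_1$, $v_b=w_{r+1}$, and edge set $\{u_1u_2,\ldots,u_{s-1}u_s\}\cup\{v_1v_2,\ldots,v_{t-1}v_t\}\cup\{w_1w_2,\ldots,w_rw_{r+1}\}$. Its only vertices of degree $3$ are $u_a$ and $v_b$. A linear configuration of a tree $T$ consists of paths $P^1_{k_1},\ldots,P^n_{k_n}$, $P^i_{k_i}=v^i_1v^i_2\cdots v^i_{k_i}$, whose vertex sets partition $V(T)$, whose edges are edges of $T$, and such that every other edge of $T$ is of the form $v^l_iv^{l+1}_j$ ($1\le l\le n-1$) with $d_T(v^l_i,v^l_{k_l})=d_T(v^{l+1}_1,v^{l+1}_j)$ and $j>1$ ($d_T$ = distance in $T$). A tree is a path-like tree if and only if it admits a linear configuration. $T$ (of type $H$) is a path-like tree with a bridge path if it admits a linear configuration in which the two vertices of degree $3$ are $\omega_1\in P^l_{k_l}$ and $\omega_2\in P^{l+m}_{k_{l+m}}$ for some $m\ge1$, where $\omega_1$ is adjacent to a vertex of $P^{l+1}_{k_{l+1}}$ and $\omega_2$ is adjacent to a vertex of $P^{l+m-1}_{k_{l+m-1}}$. *)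

(* Defs.v *)
From mathcomp Require Import all_boot.
Set Implicit Arguments.
Unset Strict Implicit.
Unset Printing Implicit Defensive.

(* Graphs are given by their adjacency relation on a finite vertex type. *)

(* x and y are consecutive, in one order or the other, in the sequence p. *)
Definition path_edge (T : eqType) (p : seq T) (x y : T) : bool :=
  ((x, y) \in zip p (behead p)) || ((y, x) \in zip p (behead p)).

Definition is_type_H (T : finType) (e : rel T) (s t r a b : nat) : Prop :=
  exists u v w : nat -> T,
    let us := [seq u i | i <- iota 1 s] in
    let vs := [seq v i | i <- iota 1 t] in
    let ws := [seq w i | i <- iota 1 r.+1] in
    [/\ u a = w 1,
        v b = w r.+1,
        (* apart from the two identifications above, the u_i, v_i, w_i are
           pairwise distinct, and they exhaust the vertex set *)
        perm_eq (us ++ vs ++ [seq w i | i <- iota 2 r.-1]) (enum T)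
      & forall x y : T,
          e x y = [|| path_edge us x y, path_edge vs x y | path_edge ws x y]].

Definition degree (T : finType) (e : rel T) (x : T) : nat := #|[set y | e x y]|.

(* Length of a shortest walk from x to y; the value is #|T| if there is none. *)
Definition dist (T : finType) (e : rel T) (x y : T) : nat :=
  find (fun n => [exists p : n.-tuple T, path e x p && (last x p == y)])
       (iota 0 #|T|).

(* Positions are counted from 0, so j > 1 for the vertex v_j reads 0 < j. *)
Definition link_edge (T : finType) (e : rel T) (P Q : seq T) (x y : T) : Prop :=
  exists i j : nat,
    [/\ i < size P, 0 < j < size Q, x = nth x P i, y = nth y Q j
      & dist e x (last x P) = dist e (head y Q) y].

Definition linear_configuration (T : finType) (e : rel T) (C : seq (seq T)) :
    Prop :=
  [/\ [::] \notin C,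
      perm_eq (flatten C) (enum T),
      (forall P : seq T, P \in C -> sorted e P)
    & forall x y : T, e x y -> ~~ has (fun P => path_edge P x y) C ->
        exists2 l : nat, l.+1 < size C &
          link_edge e (nth [::] C l) (nth [::] C l.+1) x y \/
          link_edge e (nth [::] C l) (nth [::] C l.+1) y x].

Definition path_like_with_bridge_path (T : finType) (e : rel T) : Prop :=
  exists (C : seq (seq T)) (l m : nat) (w1 w2 : T),
    linear_configuration e C /\
    [/\ 1 <= m /\ l + m < size C,
        w1 != w2 /\ [set x | degree e x == 3] = [set w1; w2],
        w1 \in nth [::] C l /\ w2 \in nth [::] C (l + m),
        (exists2 x, x \in nth [::] C (l + 1) & e w1 x)
      & (exists2 y, y \in nth [::] C (l + m - 1) & e w2 y)].

(* Main.v *)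
Require Import Defs.
From mathcomp Require Import all_boot.
From mathcomp Require Import zify.

Set Implicit Arguments.
Unset Strict Implicit.
Unset Printing Implicit Defensive.

(** In a linear configuration of a tree, consecutive rows are joined by exactly
    one edge, joining two vertices at the same distance [dl] from the end of one
    row and from the start of the next. Reading every row backwards, such an edge
    with [dl + 1] equal to both row lengths joins consecutive vertices of the
    concatenation of the rows. Any other link creates a vertex of degree 3, so with
    only two such vertices, at the two ends of the bridge, the rows before, inside
    and after the bridge have constant lengths [d1], [delta] and [d2], and the
    concatenation displays a tree of type H with [s = q1 d1], [r - 1 = m delta],
    [t = q2 d2] whose branch vertices are at distance [d1 - delta] and
    [d2 - delta] from an end of their arms. The parameters of a tree of type H
    are determined up to symmetry by the distances between its leaves and its
    branch vertices; conversely an arm and a bridge of these lengths can be cut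
    into rows. The four cases of the theorem list whether [d1 = s] and whether
    [d2 = t]. *)

(** * The type H tree on an interval of integers *)

(* The vertices [u_1 .. u_s], [w_2 .. w_r], [v_1 .. v_t] are numbered in this
   order from 0, with [g = r - 1], [i = a - 1] and [j = b - 1]; an edge is given
   by its smaller end [p] and its larger end [q]. For [g = 0] the bridge is the
   single edge between [u_a] and [v_b]. *)
Definition hedge (s g t i j p q : nat) : Prop :=
  (q = p.+1 /\ (q < s \/ (s <= p /\ q < s + g) \/ (s + g <= p /\ q < s + g + t)))
  \/ (g = 0 /\ p = i /\ q = s + j)
  \/ (0 < g /\ p = i /\ q = s)
  \/ (0 < g /\ p = s + g - 1 /\ q = s + g + j).

Definition hsym s g t i j p q := hedge s g t i j p q \/ hedge s g t i j q p.

Ltac edge_cases :=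
  case=> [[? [?|[[? ?]|[? ?]]]]|[[? [? ?]]|[[? [? ?]]|[? [? ?]]]]].

Ltac edge_search :=
  first [ left; left; lia | right; left; lia
        | left; right; left; lia | right; right; left; lia
        | left; right; right; left; lia | right; right; right; left; lia
        | left; right; right; right; lia | right; right; right; right; lia ].

Definition absd (m n : nat) := (m - n) + (n - m).

(** The candidate distance. The three regions are the first arm, the inner bridge and the second
    arm; a path leaving an arm passes through its branch vertex, [i] or [s + g + j], and the bridge
    has [g + 1] edges. A closed formula reduces metric facts to case analysis and linear
    arithmetic. *)
Definition hdist (s g i j p q : nat) : nat :=
  if p < s then
    if q < s then absd p q
    else if q < s + g then absd p i + (q - s).+1
    else absd p i + g.+1 + absd q (s + g + j)
  else if p < s + g then
    if q < s then absd q i + (p - s).+1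
    else if q < s + g then absd p q
    else (s + g - p) + absd q (s + g + j)
  else
    if q < s then absd q i + g.+1 + absd p (s + g + j)
    else if q < s + g then (s + g - q) + absd p (s + g + j)
    else absd p q.


Definition toward (p c : nat) := if p < c then p.+1 else p.-1.

(* The neighbour of [p] on the way to [y]. *)
Definition hlower (s g i j y p : nat) : nat :=
  if p < s then
    if y < s then toward p y
    else if p == i then (if g == 0 then s + j else s) else toward p i
  else if p < s + g then
    if y < s then (if p == s then i else p.-1)
    else if y < s + g then toward p y
    else if p == s + g - 1 then s + g + j else p.+1
  else
    if y < s + g then
      if p == s + g + j then (if g == 0 then i else s + g - 1)
      else toward p (s + g + j)
    else toward p y.

Section HDist.
Variables s g t i j : nat.
Local Notation N := (s + g + t).
Local Notation D := (hdist s g i j).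

Local Ltac region x :=
  case: (ltnP x s) => ?; [|case: (ltnP x (s + g)) => ?].

Lemma hdist_sym p q : D p q = D q p.
Proof. by rewrite /hdist /absd; region p; region q; lia. Qed.

Lemma hdist_refl p : D p p = 0.
Proof. by rewrite /hdist /absd; region p; lia. Qed.

Hypotheses (si : i < s) (tj : j < t).

Lemma hdist_lt p q : p < N -> q < N -> D p q < N.
Proof. by rewrite /hdist /absd => ? ?; region p; region q; lia. Qed.

Lemma hdist_edge y p q : y < N -> p < N -> q < N -> hedge s g t i j p q ->
  D y q = (D y p).+1 \/ D y p = (D y q).+1.
Proof.
rewrite /hdist /absd => ? ? ?.
edge_cases;
region p; try lia; region q; try lia; region y; lia.
Qed.

Lemma hdist_hsym y p q : y < N -> p < N -> q < N -> hsym s g t i j p q ->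
  D y q = (D y p).+1 \/ D y p = (D y q).+1.
Proof.
move=> hy hp hq [] h; first exact: hdist_edge.
by apply/or_comm; apply: hdist_edge.
Qed.

(** Absence of cycles: two neighbours of [p] closer to [y] both equal [hlower], hence coincide. *)
Lemma hlower_uniq y p q : y < N -> p < N -> q < N -> hsym s g t i j p q ->
  D y q < D y p -> q = hlower s g i j y p.
Proof.
rewrite /hdist /absd /hlower /toward => ? ? ?.
case; edge_cases;
region p; try lia; region q; try lia; region y; do ?case: ifP => ?; lia.
Qed.

Lemma hlower_spec y p (q := hlower s g i j y p) : y < N -> p < N -> y <> p ->
  [/\ q < N, hsym s g t i j p q & D y p = (D y q).+1].
Proof.
move=> ? ? ?.
have hq : q < N.
  rewrite /q /hlower /toward; region p; region y; do ?case: ifP => ?; lia.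
have hE : hsym s g t i j p q.
  rewrite /hsym /hedge /q /hlower /toward.
  region p; region y; do ?case: ifP => ?;
  edge_search.
split=> //; have [] // := @hdist_hsym y p q => //.
(* The equation for [q] is kept while its body is forgotten, so that the region of [q] can be split
   independently of the formula defining it. *)
have := erefl q; rewrite {2}/q /hlower /toward {hE}.
move: q hq => q hq; rewrite /hdist /absd.
by region p; region y; do ?[case: ifP => ?] => ?; region q; lia.
Qed.
End HDist.

(** * Trees and numberings of their vertices *)

(** [dist] is the first length for which a walk of exactly that length exists, searched below
    [#|T|]; the bound on [d] keeps the search within its range. *)
Lemma dist_eq (T : finType) (e : rel T) (x y : T) (d : nat) :
  d < #|T| ->
  (exists p, [/\ size p = d, path e x p & last x p = y]) ->
  (forall p, path e x p -> last x p = y -> d <= size p) ->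
  dist e x y = d.
Proof.
move=> hd [p [sp ep lp]] hmin; rewrite /dist; set a := (X in find X _).
have ad : a d.
  apply/existsP; exists (Tuple (introT eqP sp)) => /=.
  by rewrite ep lp eqxx.
have hasa : has a (iota 0 #|T|).
  by apply/hasP; exists d => //; rewrite mem_iota.
have := hasa; rewrite has_find size_iota => hf.
case: (ltngtP (find a (iota 0 #|T|)) d) => // hlt.
- have := nth_find 0 hasa; rewrite nth_iota // add0n.
  case/existsP=> q /andP[eq /eqP lq].
  by have := hmin _ eq lq; rewrite size_tuple => ?; lia.
- by have := before_find 0 hlt; rewrite nth_iota ?add0n ?ad //.
Qed.

(** A tree described through distances: along an edge the distance to [y] changes by exactly one, at
    most one neighbour is closer to [y] (no cycle), and away from [y] there is one (connectedness).
    The analysis of configurations uses trees only in this form. *)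
Definition treelike (T : finType) (e : rel T) : Prop :=
  [/\ symmetric e,
      forall y, dist e y y = 0,
      forall y x z, e x z ->
        dist e y z = (dist e y x).+1 \/ dist e y x = (dist e y z).+1,
      forall y x z z', e x z -> e x z' ->
        dist e y z < dist e y x -> dist e y z' < dist e y x -> z = z'
    & forall y x, x <> y -> exists2 z, e x z & dist e y x = (dist e y z).+1].

(* A walk that never turns back keeps moving away from its start, since each
   vertex has only one neighbour closer to the start. *)
Lemma treelike_walk_dist (T : finType) (e : rel T) (f : nat -> T) (n : nat) :
  treelike e ->
  (forall i, i < n -> e (f i) (f i.+1)) ->
  (forall i, i.+1 < n -> f i <> f i.+2) ->
  dist e (f 0) (f n) = n.
Proof.
move=> [sym d0 step uniq_low _] ef nb.
have H : forall i, i <= n -> dist e (f 0) (f i) = i /\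
    (i < n -> dist e (f 0) (f i.+1) = i.+1).
  elim=> [|i IH] hi.
    split=> [|/ef h]; first exact: d0.
    by case: (step (f 0) _ _ h); rewrite d0.
  have [hi0 /(_ hi) hi1] := IH (ltnW hi); split=> // hi2.
  case: (step (f 0) _ _ (ef _ hi2)); rewrite hi1 // => -[hlow].
  case: (nb i hi2); apply: (uniq_low (f 0) (f i.+1)).
  - by rewrite sym; apply: ef.
  - exact: ef.
  - by rewrite hi0 hi1.
  - by rewrite hi1 -hlow.
by case: (H n (leqnn n)).
Qed.

(** An injective walk never turns back. Both reading directions are treated, since symmetry of
    [dist] is not among the properties in [treelike]. *)
Lemma treelike_path_dist (T : finType) (e : rel T) (f : nat -> T) (n c c' : nat) :
  treelike e ->
  (forall i, i.+1 < n -> e (f i) (f i.+1)) ->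
  (forall i j, i < n -> j < n -> f i = f j -> i = j) ->
  c <= c' -> c' < n ->
  dist e (f c) (f c') = c' - c /\ dist e (f c') (f c) = c' - c.
Proof.
move=> treee ef inj hcc hc'; case: (treee) => sym _ _ _ _; split.
  have := @treelike_walk_dist _ e (fun i => f (c + i)) (c' - c) treee.
  rewrite addn0 subnKC //; apply=> [i hi|i hi /inj].
    by rewrite addnS; apply: ef; lia.
  by move=> E; have := E _ _; lia.
have := @treelike_walk_dist _ e (fun i => f (c' - i)) (c' - c) treee.
rewrite subn0 subKn //; apply=> [i hi|i hi /inj].
  rewrite sym; have -> : c' - i = (c' - i.+1).+1 by lia.
  by apply: ef; lia.
by move=> E; have := E _ _; lia.
Qed.

(** Descend from [x] to [y] through ever closer neighbours, then carry [S] back along the same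
    edges. *)
Lemma treelike_connected (T : finType) (e : rel T) (S : T -> Prop) (y : T) :
  treelike e -> S y -> (forall x z, S x -> e x z -> S z) -> forall x, S x.
Proof.
move=> [sym _ _ _ low] Sy cl x.
move: {2}(dist e y x) (leqnn (dist e y x)) => n.
elim: n x => [|n IH] x hx.
all: have [->//|/eqP/(low y)[z exz hz]] := eqVneq x y.
- by move: hx; rewrite hz.
- by apply: (cl z); [apply: IH; lia | rewrite sym].
Qed.

(** An isomorphism from the positions below [N], with the symmetric closure of [R], onto the graph.
    [X] is total but constrained only below [N]. *)
Definition numbering (T : finType) (e : rel T) (N : nat)
    (R : nat -> nat -> Prop) (X : nat -> T) : Prop :=
  [/\ forall p q, p < N -> q < N -> X p = X q -> p = q,
      forall x, exists2 p, p < N & x = X p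
    & forall p q, p < N -> q < N -> (e (X p) (X q) <-> R p q \/ R q p)].

Lemma numbering_perm (T : finType) (e : rel T) N R (X : nat -> T) :
  numbering e N R X -> perm_eq [seq X p | p <- iota 0 N] (enum T).
Proof.
move=> [inj sur _]; apply: uniq_perm; last 1 first.
- move=> x; rewrite mem_enum inE; have [p hp ->] := sur x.
  by apply: map_f; rewrite mem_iota.
- rewrite map_inj_in_uniq ?iota_uniq // => p q.
  by rewrite !mem_iota !add0n; apply: inj.
- exact: enum_uniq.
Qed.

Lemma numbering_card (T : finType) (e : rel T) N R (X : nat -> T) :
  numbering e N R X -> #|T| = N.
Proof.
by move/numbering_perm/perm_size; rewrite size_map size_iota cardE => ->.
Qed.

Definition hnumbering (T : finType) (e : rel T) (s g t i j : nat) X :=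
  numbering e (s + g + t) (hedge s g t i j) X.

Section HNumbering.
Variables (T : finType) (e : rel T) (s g t i j : nat) (X : nat -> T).
Hypotheses (si : i < s) (tj : j < t) (hX : hnumbering e s g t i j X).
Local Notation N := (s + g + t).
Local Notation D := (hdist s g i j).

Lemma hnumbering_dist p q : p < N -> q < N -> dist e (X p) (X q) = D p q.
Proof.
have [inj sur ed] := hX; move=> hp hq; apply: dist_eq.
- by rewrite (numbering_card hX); apply: hdist_lt.
(* A walk of length [D p q] is built backwards from [q] by repeated use of [hlower]. *)
- move: {2}(D p q) (leqnn (D p q)) => n.
  have base : exists c, [/\ size c = D p p, path e (X p) c & last (X p) c = X p].
    by exists [::]; rewrite hdist_refl.
  elim: n q hq => [|n IH] q hq hD; have [<-//|/eqP hpq] := eqVneq p q.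
    by have [_ _ hDl] := hlower_spec si tj hp hq hpq; rewrite hDl in hD.
  have [hl hE hDl] := hlower_spec si tj hp hq hpq.
  have [|c [sc ec lc]] := IH _ hl; first by lia.
  exists (rcons c (X q)); split; rewrite ?last_rcons // ?size_rcons ?sc //.
  by rewrite rcons_path ec lc; apply/(ed _ _ hl hq)/or_comm.
(* No walk is shorter: each edge changes the distance to [q] by one. *)
- have Hc : forall c p', p' < N -> path e (X p') c -> last (X p') c = X q ->
      D q p' <= size c.
    elim=> [|x c IH] p' hp' /=.
      by move=> _ /inj -> //; rewrite hdist_refl.
    have [p2 hp2 ->] := sur x; case/andP=> /(ed _ _ hp' hp2) h12 hc lc.
    have := IH _ hp2 hc lc; have := hdist_hsym si tj hq hp' hp2 h12; lia.
  by move=> c hc lc; rewrite hdist_sym //; apply: Hc.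
Qed.

Lemma hnumbering_treelike : treelike e.
Proof.
have [inj sur ed] := hX; split.
- move=> x y; have [p hp ->] := sur x; have [q hq ->] := sur y.
  apply/idP/idP => h.
    by apply/(ed _ _ hq hp)/or_comm/(ed _ _ hp hq).
  by apply/(ed _ _ hp hq)/or_comm/(ed _ _ hq hp).
- move=> y; have [p hp ->] := sur y; rewrite hnumbering_dist //.
  exact: hdist_refl.
- move=> y x z; have [p hp ->] := sur y; have [q hq ->] := sur x.
  have [u hu ->] := sur z => /ed h.
  by rewrite !hnumbering_dist //; apply: (hdist_hsym si tj) => //; apply: h.
- move=> y x z z'; have [p hp ->] := sur y; have [q hq ->] := sur x.
  have [u hu ->] := sur z; have [u' hu' ->] := sur z' => /ed h /ed h'.
  rewrite !hnumbering_dist // => l l'; congr X.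
  rewrite (hlower_uniq si tj hp hq hu (h hq hu) l).
  by rewrite (hlower_uniq si tj hp hq hu' (h' hq hu') l').
- move=> y x; have [p hp ->] := sur y; have [q hq ->] := sur x => hpq.
  have [|hl hE hD] := hlower_spec si tj hp hq; first by move=> E; rewrite E in hpq.
  by exists (X (hlower s g i j p q)); rewrite ?hnumbering_dist //; apply/ed.
Qed.
End HNumbering.

(** * Numbering a tree presented as type H *)

Lemma path_edgeP (T : eqType) (x0 : T) (c : seq T) (x y : T) :
  reflect (exists2 k, k.+1 < size c &
             x = nth x0 c k /\ y = nth x0 c k.+1 \/
             y = nth x0 c k /\ x = nth x0 c k.+1)
          (path_edge c x y).
Proof.
have zipP u v : (u, v) \in zip c (behead c) <->
    exists2 k, k.+1 < size c & u = nth x0 c k /\ v = nth x0 c k.+1.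
  split.
    case/(nthP (x0, x0)) => k hk; rewrite nth_zip_cond hk nth_behead.
    case=> <- <-; exists k => //.
    by move: hk; rewrite size_zip size_behead; lia.
  case=> k hk [-> ->]; have hk' : k < size (zip c (behead c)).
    by rewrite size_zip size_behead; lia.
  by apply/(nthP (x0, x0)); exists k => //; rewrite nth_zip_cond hk' nth_behead.
apply: (iffP orP) => [[/zipP|/zipP]|[k hk [h|h]]].
- by case=> k hk h; exists k => //; left.
- by case=> k hk h; exists k => //; right.
- by left; apply/zipP; exists k.
- by right; apply/zipP; exists k.
Qed.

Lemma type_H_numbering (T : finType) (e : rel T) (s t r a b : nat) :
  1 <= r -> 1 < a < s -> 1 < b < t -> is_type_H e s t r a b ->
  exists X, hnumbering e s (r - 1) t (a - 1) (b - 1) X.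
Proof.
move=> hr ha hb [u [v [w]]]; lazy zeta.
set us := [seq u k | k <- _]; set vs := [seq v k | k <- _].
set ws := [seq w k | k <- iota 1 _]; set ms := [seq w k | k <- iota 2 _].
move=> [ua vb perm ed].
have sus : size us = s by rewrite size_map size_iota.
have svs : size vs = t by rewrite size_map size_iota.
have sms : size ms = r - 1 by rewrite size_map size_iota subn1.
have sws : size ws = r.+1 by rewrite size_map size_iota.
pose x0 := u 0.
have nus k : k < s -> nth x0 us k = u k.+1.
  by move=> hk; rewrite (nth_map 0) ?size_iota // nth_iota.
have nvs k : k < t -> nth x0 vs k = v k.+1.
  by move=> hk; rewrite (nth_map 0) ?size_iota // nth_iota.
have nms k : k < r - 1 -> nth x0 ms k = w k.+2.
  by move=> hk; rewrite (nth_map 0) ?size_iota ?nth_iota ?add2n // -subn1.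
have nws k : k < r.+1 -> nth x0 ws k = w k.+1.
  by move=> hk; rewrite (nth_map 0) ?size_iota // nth_iota.
pose g := r - 1; rewrite -/g.
pose L := us ++ vs ++ ms.
(* [L] follows the order of the definition, with the inner bridge last; [pi] translates from
   positions in which the inner bridge lies between the arms. *)
pose pi p := if p < s then p else if p < s + g then t + p else p - g.
have pi_lt p : p < s + g + t -> pi p < size L.
  by rewrite /pi !size_cat sus svs sms; do !case: ifP => ?; lia.
have pi_inj p q : p < s + g + t -> q < s + g + t -> pi p = pi q -> p = q.
  by rewrite /pi => ? ?; do !case: ifP => ?; lia.
have uL : uniq L by rewrite (perm_uniq perm) enum_uniq.
pose X p := nth x0 L (pi p).
have XA p : p < s -> X p = u p.+1.
  by move=> hp; rewrite /X /pi hp nth_cat sus hp nus.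
have XM p : p < g -> X (s + p) = w p.+2.
  move=> hp; rewrite /X /pi ltnNge leq_addr /= ltn_add2l hp.
  rewrite !nth_cat sus svs ifN ?ifN -?leqNgt; try lia.
  by rewrite -nms //; congr nth; lia.
have XB p : p < t -> X (s + g + p) = v p.+1.
  move=> hp; rewrite /X /pi ifN ?ifN -?leqNgt; try lia.
  rewrite nth_cat sus ifN -?leqNgt ?nth_cat ?svs ?ifT; try lia.
  by rewrite -nvs //; congr nth; lia.
have inj p q : p < s + g + t -> q < s + g + t -> X p = X q -> p = q.
  move=> hp hq /eqP; rewrite nth_uniq ?pi_lt // => /eqP; exact: pi_inj.
(* [W k] is the position of [w k.+1]. Its values at 0 and [r] are the branch vertices; for [r = 1]
   nothing lies in between. *)
pose W k := if k == 0 then a - 1 else if k < r then s + (k - 1) else s + g + (b - 1).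
have W_lt k : k <= r -> W k < s + g + t.
  by rewrite /W => ?; do !case: ifP => ?; lia.
have XW k : k <= r -> w k.+1 = X (W k).
  rewrite /W => hk; case: eqP => [->|hk0].
    by rewrite XA ?subn1 ?prednK -?ua; lia || done.
  case: ltnP => hkr.
    by rewrite XM; [congr w; lia|lia].
  rewrite XB; last lia.
  by have -> : k = r; [lia|rewrite subn1 prednK -?vb; lia || done].
exists X; split=> //.
- move=> x; have : x \in L by rewrite (perm_mem perm) mem_enum.
  rewrite !mem_cat => /or3P[] /(nthP x0)[k].
  + rewrite sus => hk <-; exists k; first lia.
    by rewrite nus // XA.
  + rewrite svs => hk <-; exists (s + g + k); first lia.
    by rewrite nvs // XB.
  + rewrite sms => hk <-; exists (s + k); first lia.
    by rewrite nms // XM.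
move=> p q hp hq; rewrite ed; split.
  have key k l : k < s + g + t -> l < s + g + t ->
      hedge s g t (a - 1) (b - 1) k l ->
      X p = X k /\ X q = X l \/ X q = X k /\ X p = X l ->
      hedge s g t (a - 1) (b - 1) p q \/ hedge s g t (a - 1) (b - 1) q p.
    move=> hk hl hkl [] [/inj h1 /inj h2].
      by left; rewrite h1 // h2.
    by right; rewrite h1 // h2.
  case/or3P => /(path_edgeP x0)[k]; rewrite ?sus ?svs ?sws => hk.
  + by rewrite !nus -?XA; try lia; apply: key; try lia; left; lia.
  + rewrite !nvs -?XB; try lia; apply: key; try lia.
    by left; lia.
  + rewrite !nws ?XW; try lia; apply: key; rewrite ?W_lt //; try lia.
    rewrite /W /hedge; do !case: ifP => ?;
    first [left; lia|right; left; lia|right; right; left; lia|right; right; right; lia].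
have key k l : hedge s g t (a - 1) (b - 1) k l -> k < s + g + t -> l < s + g + t ->
    (forall x y, x = X k /\ y = X l \/ y = X k /\ x = X l ->
    [|| path_edge us x y, path_edge vs x y | path_edge ws x y]).
  move=> h hk hl x y; case: h => [[-> [?|[[? ?]|[? ?]]]]|[[? [-> ->]]|[[? [-> ->]]|[? [-> ->]]]]] h.
  + apply/or3P; constructor 1; apply/(path_edgeP x0).
    by exists k; rewrite ?sus ?nus -?XA; lia || done.
  + apply/or3P; constructor 3; apply/(path_edgeP x0).
    exists (k - s).+1; rewrite ?sws ?nws; try lia.
    rewrite -!XM; try lia.
    by move: h; rewrite addnS subnKC.
  + apply/or3P; constructor 2; apply/(path_edgeP x0).
    exists (k - (s + g)); rewrite ?svs ?nvs; try lia.
    rewrite -!XB; try lia.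
    by move: h; rewrite addnS subnKC.
  + apply/or3P; constructor 3; apply/(path_edgeP x0).
    exists 0; rewrite ?sws ?nws ?XW; try lia.
    move: h; have -> : W 1 = s + (b - 1) by rewrite /W; case: ifP; lia.
    by [].
  + apply/or3P; constructor 3; apply/(path_edgeP x0).
    exists 0; rewrite ?sws ?nws ?XW; try lia.
    move: h; have -> : W 1 = s by rewrite /W; case: ifP; lia.
    by [].
  + apply/or3P; constructor 3; apply/(path_edgeP x0).
    exists r.-1; rewrite ?sws ?nws ?XW; try lia.
    move: h; rewrite prednK //.
    have -> : W r = s + g + (b - 1) by rewrite /W; do !case: ifP; lia.
    have -> : W r.-1 = s + g - 1 by rewrite /W; do !case: ifP; lia.
    by [].
by case=> h; apply: (key _ _ h) => //; [left|right].
Qed.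

(** * Symmetries of a type H tree *)

(** The relabellings needed are involutions, so one map [f] transports edges both ways. *)
Lemma numbering_relabel (T : finType) (e : rel T) N (R R' : nat -> nat -> Prop)
    (f : nat -> nat) X :
  (forall p, p < N -> f p < N) -> (forall p, p < N -> f (f p) = p) ->
  (forall p q, p < N -> q < N -> R p q -> R' (f p) (f q) \/ R' (f q) (f p)) ->
  (forall p q, p < N -> q < N -> R' p q -> R (f p) (f q) \/ R (f q) (f p)) ->
  numbering e N R X -> numbering e N R' (X \o f).
Proof.
move=> fN fK RR' R'R [inj sur ed]; split=> /=.
- move=> p q hp hq /inj E; rewrite -(fK p) // -(fK q) //; congr f.
  by apply: E; apply: fN.
- by move=> x; have [p hp ->] := sur x; exists (f p); rewrite ?fK ?fN.
move=> p q hp hq; have hfp := fN p hp; have hfq := fN q hq.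
split=> [/ed-/(_ hfp)-/(_ hfq)[] h|[] h].
- by have := RR' _ _ hfp hfq h; rewrite !fK.
- by apply/or_comm; have := RR' _ _ hfq hfp h; rewrite !fK.
- by apply/ed=> //; apply: R'R.
- by apply/ed=> //; apply/or_comm; apply: R'R.
Qed.

Section Symmetries.
Variables (T : finType) (e : rel T) (s g t i j : nat) (X : nat -> T).
Hypotheses (si : i < s) (tj : j < t) (hX : hnumbering e s g t i j X).

Lemma hnumbering_revl : exists X', hnumbering e s g t (s - 1 - i) j X'.
Proof.
exists (X \o (fun p => if p < s then s - 1 - p else p)).
apply: numbering_relabel hX => [p ?|p ?|p q ? ?|p q ? ?].
- by case: ifP => ?; lia.
- by case: (ltnP p s) => ?; case: ifP => ?; lia.
all: by edge_cases; case: (ltnP p s) => ?; try lia;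
  case: (ltnP q s) => ?; try lia; edge_search.
Qed.

Lemma hnumbering_revr : exists X', hnumbering e s g t i (t - 1 - j) X'.
Proof.
exists (X \o (fun p => if p < s + g then p else s + g + (s + g + t - 1 - p))).
apply: numbering_relabel hX => [p ?|p ?|p q ? ?|p q ? ?].
- by case: ifP => ?; lia.
- by case: (ltnP p (s + g)) => ?; case: ifP => ?; lia.
all: by edge_cases; case: (ltnP p (s + g)) => ?; try lia;
  case: (ltnP q (s + g)) => ?; try lia; edge_search.
Qed.

(** Reading all positions backwards exchanges the arms and reverses each of them, hence the
    complemented [i] and [j]. *)
Lemma hnumbering_swap :
  hnumbering e t g s (t - 1 - j) (s - 1 - i) (fun p => X (s + g + t - 1 - p)).
Proof.
rewrite /hnumbering [t + g + s]addnC [t + g]addnC addnA.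
apply: (@numbering_relabel _ _ _ _ _ (fun p => s + g + t - 1 - p)) hX => [p ?|p ?|p q ? ?|p q ? ?].
- by lia.
- by lia.
all: by edge_cases; edge_search.
Qed.
End Symmetries.

(** * Degrees, leaves and uniqueness of the parameters *)

Section Neighbours.
Variables (s g t i j : nat).
Hypotheses (si : i < s) (tj : j < t).

(** With the two neighbour lists that follow, degree bounds become a pigeonhole count: three
    distinct neighbours force a branch vertex, four are impossible. *)
Lemma hsym_nbrA p q : p < s -> hsym s g t i j p q ->
  q.+1 = p \/ (q = p.+1 /\ q < s) \/ p = i /\ q = (if g == 0 then s + j else s).
Proof. by move=> ?; case; edge_cases; case: eqP => ?; lia. Qed.

Lemma hsym_nbrM p q : s <= p < s + g -> hsym s g t i j p q ->
  q = (if p == s then i else p.-1) \/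
  q = (if p == s + g - 1 then s + g + j else p.+1).
Proof. by move=> ?; case; edge_cases; do 2!case: eqP => ?; lia. Qed.

Lemma hsym_nbrB p q : s + g <= p < s + g + t -> hsym s g t i j p q ->
  (q.+1 = p /\ s + g <= q) \/ (q = p.+1 /\ q < s + g + t) \/
  p = s + g + j /\ q = (if g == 0 then i else s + g - 1).
Proof. by move=> ?; case; edge_cases; case: eqP => ?; lia. Qed.

Lemma hsym_branch p q1 q2 q3 : p < s + g + t ->
  hsym s g t i j p q1 -> hsym s g t i j p q2 -> hsym s g t i j p q3 ->
  q1 <> q2 -> q2 <> q3 -> q3 <> q1 ->
  (p = i /\ 0 < i < s - 1) \/ (p = s + g + j /\ 0 < j < t - 1).
Proof.
move=> hp h1 h2 h3 ? ? ?; case: (ltnP p s) => hs.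
  move: (hsym_nbrA hs h1) (hsym_nbrA hs h2) (hsym_nbrA hs h3).
  by case=> [?|[?|[? ?]]] [?|[?|[? ?]]] [?|[?|[? ?]]]; lia.
case: (ltnP p (s + g)) => hg.
  have hsg : s <= p < s + g by lia.
  move: (hsym_nbrM hsg h1) (hsym_nbrM hsg h2) (hsym_nbrM hsg h3).
  by case=> ? [] ? [] ?; lia.
have hsg : s + g <= p < s + g + t by lia.
move: (hsym_nbrB hsg h1) (hsym_nbrB hsg h2) (hsym_nbrB hsg h3).
by case=> [?|[?|[? ?]]] [?|[?|[? ?]]] [?|[?|[? ?]]]; lia.
Qed.

Lemma hsym_nbr4 p q1 q2 q3 q4 : p < s + g + t ->
  hsym s g t i j p q1 -> hsym s g t i j p q2 -> hsym s g t i j p q3 ->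
  hsym s g t i j p q4 -> uniq [:: q1; q2; q3; q4] -> False.
Proof.
move=> hp h1 h2 h3 h4 /=; rewrite !inE => hu; case: (ltnP p s) => hs.
  move: (hsym_nbrA hs h1) (hsym_nbrA hs h2) (hsym_nbrA hs h3) (hsym_nbrA hs h4).
  by case=> [?|[?|[_ ?]]] [?|[?|[_ ?]]] [?|[?|[_ ?]]] [?|[?|[_ ?]]]; lia.
case: (ltnP p (s + g)) => hg.
  have hsg : s <= p < s + g by lia.
  move: (hsym_nbrM hsg h1) (hsym_nbrM hsg h2) (hsym_nbrM hsg h3).
  by case=> ? [] ? [] ?; lia.
have hsg : s + g <= p < s + g + t by lia.
move: (hsym_nbrB hsg h1) (hsym_nbrB hsg h2) (hsym_nbrB hsg h3) (hsym_nbrB hsg h4).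
by case=> [?|[?|[_ ?]]] [?|[?|[_ ?]]] [?|[?|[_ ?]]] [?|[?|[_ ?]]]; lia.
Qed.

Lemma hsym_leaf p q1 q2 : 0 < i < s - 1 -> 0 < j < t - 1 ->
  p \in [:: 0; s - 1; s + g; s + g + t - 1] ->
  hsym s g t i j p q1 -> hsym s g t i j p q2 -> q1 = q2.
Proof.
rewrite !inE => hi hj hp h1 h2; case: (ltnP p s) => hs.
  by move: (hsym_nbrA hs h1) (hsym_nbrA hs h2); case: eqP => ?; lia.
have hsg : s + g <= p < s + g + t by lia.
by move: (hsym_nbrB hsg h1) (hsym_nbrB hsg h2); case: eqP => ?; lia.
Qed.

Lemma hsym_leafN p : 0 < i < s - 1 -> 0 < j < t - 1 -> p < s + g + t ->
  (forall q1 q2, q1 < s + g + t -> q2 < s + g + t ->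
     hsym s g t i j p q1 -> hsym s g t i j p q2 -> q1 = q2) ->
  p \in [:: 0; s - 1; s + g; s + g + t - 1].
Proof.
move=> hi hj hp H; rewrite !inE.
case: (ltnP p s) => hs.
  case: (posnP p) => [->//|h0]; case: (eqVneq p (s - 1)) => [->|h1].
    by rewrite orbT.
  suff : p.-1 = p.+1 by lia.
  by apply: H; try lia; edge_search.
case: (ltnP p (s + g)) => hg.
  pose q1 := if p == s then i else p.-1.
  pose q2 := if p == s + g - 1 then s + g + j else p.+1.
  suff : q1 = q2 by rewrite /q1 /q2; do 2!case: eqP => ?; lia.
  by apply: H; rewrite /q1 /q2; do ?[case: eqP => ?]; try lia; edge_search.
case: (eqVneq p (s + g)) => [->|h0]; first by rewrite !orbT.
case: (eqVneq p (s + g + t - 1)) => [->|h1]; first by rewrite !orbT.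
suff : p.-1 = p.+1 by lia.
by apply: H; try lia; edge_search.
Qed.
End Neighbours.

Section Degrees.
Variables (T : finType) (e : rel T) (s g t i j : nat) (X : nat -> T).
Hypotheses (si : i < s) (tj : j < t) (hX : hnumbering e s g t i j X).
Local Notation N := (s + g + t).

Lemma hnumbering_degree_le3 x : degree e x <= 3.
Proof.
have [inj sur ed] := hX; rewrite leqNgt; apply/negP=> /card_geqP[l []].
case: l => [|y1 [|y2 [|y3 [|y4 []]]]] // + _ sub.
have nb y : y \in [:: y1; y2; y3; y4] -> e x y by move/sub; rewrite inE.
move: (nb y1) (nb y2) (nb y3) (nb y4) => {nb sub}.
rewrite !inE !eqxx !orbT => /(_ isT) + /(_ isT) + /(_ isT) + /(_ isT).
have [p hp ->] := sur x.
have [q1 h1 ->] := sur y1; have [q2 h2 ->] := sur y2.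
have [q3 h3 ->] := sur y3; have [q4 h4 ->] := sur y4.
move=> /(ed _ _ hp h1) e1 /(ed _ _ hp h2) e2 /(ed _ _ hp h3) e3 /(ed _ _ hp h4) e4 u.
apply: (hsym_nbr4 si tj hp e1 e2 e3 e4).
by move: u; rewrite -[[:: X q1; _; _; _]]/(map X [:: q1; q2; q3; q4]) => /map_uniq.
Qed.

(** The bounds on [i] and [j] belong to the conclusion: an arm attached at its end has no vertex of
    degree 3, so a branch vertex certifies that its arm is attached at an inner point. *)
Lemma hnumbering_branch p : p < N -> 2 < degree e (X p) ->
  (p = i /\ 0 < i < s - 1) \/ (p = s + g + j /\ 0 < j < t - 1).
Proof.
have [inj sur ed] := hX; move=> hp /card_gt2P[y1 [y2 [y3 []]]].
rewrite !inE.
have [q1 h1 ->] := sur y1; have [q2 h2 ->] := sur y2; have [q3 h3 ->] := sur y3.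
move=> [/(ed _ _ hp h1) e1 /(ed _ _ hp h2) e2 /(ed _ _ hp h3) e3] [d1 d2 d3].
by apply: (hsym_branch si tj hp e1 e2 e3) => E; move: d1 d2 d3; rewrite E eqxx.
Qed.

(** Stated for any numbering, because it serves both type H numberings and the rows of a
    configuration. *)
Lemma numbering_degree_gt2 N' (R : nat -> nat -> Prop) (Y : nat -> T) p q1 q2 q3 :
  numbering e N' R Y -> p < N' -> q1 < N' -> q2 < N' -> q3 < N' ->
  (R p q1 \/ R q1 p) -> (R p q2 \/ R q2 p) -> (R p q3 \/ R q3 p) ->
  q1 <> q2 -> q2 <> q3 -> q3 <> q1 -> 2 < degree e (Y p).
Proof.
move=> [inj _ ed] hp h1 h2 h3 e1 e2 e3 n12 n23 n31.
apply/card_gt2P; exists (Y q1), (Y q2), (Y q3); rewrite !inE; split.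
  by split; apply/ed.
by split; apply/eqP=> /inj-E; [apply: n12|apply: n23|apply: n31]; apply: E.
Qed.

Lemma hnumbering_degreeA : 0 < i < s - 1 -> degree e (X i) = 3.
Proof.
move=> hi; apply/eqP; rewrite eqn_leq hnumbering_degree_le3 /=.
apply: (numbering_degree_gt2 (q1 := i.-1) (q2 := i.+1)
  (q3 := if g == 0 then s + j else s) hX); try case: eqP => ?; try lia.
- by right; left; lia.
- by left; left; lia.
- by left; right; left; lia.
- by left; right; right; left; lia.
Qed.

Lemma hnumbering_degreeB : 0 < j < t - 1 -> degree e (X (s + g + j)) = 3.
Proof.
move=> hi; apply/eqP; rewrite eqn_leq hnumbering_degree_le3 /=.
apply: (numbering_degree_gt2 (q1 := s + g + j.-1) (q2 := s + g + j.+1)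
  (q3 := if g == 0 then i else s + g - 1) hX); try case: eqP => ?; try lia.
all: edge_search.
Qed.
End Degrees.

Lemma hdist_branchA s g i j p : i < s -> p < s ->
  hdist s g i j p i = absd p i /\ hdist s g i j p (s + g + j) = absd p i + g.+1.
Proof.
move=> si ps; have h := leq_addr j (s + g).
rewrite /hdist si ps !ltnNge h (leq_trans (leq_addr g s) h) /= /absd.
by split; lia.
Qed.

Lemma hdist_branchB s g i j p : i < s -> s + g <= p ->
  hdist s g i j p i = absd p (s + g + j) + g.+1 /\
  hdist s g i j p (s + g + j) = absd p (s + g + j).
Proof.
move=> si ps; have [h1 h2] := (leq_trans (leq_addr g s) ps, leq_addr j (s + g)).
rewrite /hdist /absd si !ltnNge h1 ps /= h2 (leq_trans (leq_addr g s) h2) /=.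
by split; lia.
Qed.

(** Phrased through [e] alone, so that leaves can be compared between two numberings of one tree. *)
Definition leaf (T : finType) (e : rel T) (x : T) :=
  forall y z, e x y -> e x z -> y = z.

Lemma hnumbering_leaf (T : finType) (e : rel T) s g t i j X p :
  0 < i < s - 1 -> 0 < j < t - 1 -> hnumbering e s g t i j X -> p < s + g + t ->
  leaf e (X p) <-> p \in [:: 0; s - 1; s + g; s + g + t - 1].
Proof.
move=> hi hj [inj sur ed] hp; have [si tj] : i < s /\ j < t by lia.
split=> [lf|hin].
  apply: (hsym_leafN si tj) => // q1 q2 h1 h2 e1 e2.
  by apply: inj => //; apply: lf; apply/ed.
move=> y z; have [q1 h1 ->] := sur y; have [q2 h2 ->] := sur z.
move=> /(ed _ _ hp h1) e1 /(ed _ _ hp h2) e2; congr X.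
exact: (hsym_leaf si tj hi hj hin e1 e2).
Qed.

Section Uniqueness.
Variables (T : finType) (e : rel T) (s g t i j s' g' t' i' j' : nat).
Variables (X X' : nat -> T).
Hypotheses (hi : 0 < i < s - 1) (hj : 0 < j < t - 1).
Hypotheses (hX : hnumbering e s g t i j X) (hX' : hnumbering e s' g' t' i' j' X').

(** Equality of arms with a marked vertex, up to reversal. *)
Definition same_arm (s i s' i' : nat) := s' = s /\ (i' = i \/ i' = s - 1 - i).

(** The branch vertices are [g + 1] apart, which fixes [g]. A leaf is nearer to the branch vertex of
    its own arm, so leaves of corresponding arms match, and the two distances from the leaves to the
    branch vertex give the arm up to reversal. *)
Lemma hnumbering_params_aligned :
  0 < i' < s' - 1 -> 0 < j' < t' - 1 ->
  X i = X' i' -> X (s + g + j) = X' (s' + g' + j') ->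
  [/\ g = g', same_arm s i s' i' & same_arm t j t' j'].
Proof.
move=> hi' hj' E1 E2; have [inj sur ed] := hX; have [inj' _ _] := hX'.
have [[si tj] [si' tj']] : (i < s /\ j < t) /\ (i' < s' /\ j' < t') by lia.
have hw1 : i < s + g + t by lia.
have hw2 : s + g + j < s + g + t by lia.
have hw1' : i' < s' + g' + t' by lia.
have hw2' : s' + g' + j' < s' + g' + t' by lia.
have dE := hnumbering_dist si tj hX; have dE' := hnumbering_dist si' tj' hX'.
have gg : g = g'.
  have : hdist s g i j i (s + g + j) = hdist s' g' i' j' i' (s' + g' + j').
    by rewrite -dE // -dE' // E1 E2.
  have [_ ->] := hdist_branchA g j si si; have [_ ->] := hdist_branchA g' j' si' si'.
  by rewrite /absd; lia.
have dd p p' : p < s + g + t -> p' < s' + g' + t' -> X p = X' p' ->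
    hdist s g i j p i = hdist s' g' i' j' p' i' /\
    hdist s g i j p (s + g + j) = hdist s' g' i' j' p' (s' + g' + j').
  by move=> hp hp' E; rewrite -!dE // -!dE' // E E1 E2.
have lf p' : p' < s' + g' + t' -> p' \in [:: 0; s' - 1; s' + g'; s' + g' + t' - 1] ->
   exists p, [/\ p < s + g + t, X p = X' p' & p \in [:: 0; s - 1; s + g; s + g + t - 1]].
  move=> hp' hin; have [p hp E] := sur (X' p'); exists p; split=> //.
  apply/(hnumbering_leaf hi hj hX hp); rewrite -E.
  by apply/(hnumbering_leaf hi' hj' hX' hp').
(* The distances from this leaf to the first and second branch vertex differ by [g + 1], the second
   being larger; on the second arm it would be the smaller one. *)
have armA p' : p' \in [:: 0; s' - 1] -> exists2 p, p \in [:: 0; s - 1] &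
    X p = X' p' /\ absd p i = absd p' i'.
  rewrite !inE => hp'; have hpN : p' < s' + g' + t' by lia.
  have [|p [hp E hin]] := lf p' hpN; first by rewrite !inE; lia.
  have [] := dd _ _ hp hpN E; move: hin; rewrite !inE => hin.
  have [|-> ->] := hdist_branchA g' j' si' (_ : p' < s'); first lia.
  case: (ltnP p s) => hps.
    have [-> ->] := hdist_branchA g j si hps.
    by exists p; last split=> //; rewrite ?inE; lia.
  have [|-> ->] := hdist_branchB j si (_ : s + g <= p); first lia.
  by exists p; last split=> //; rewrite ?inE; lia.
have armB p' : p' \in [:: s' + g'; s' + g' + t' - 1] ->
    exists2 p, p \in [:: s + g; s + g + t - 1] &
    X p = X' p' /\ absd p (s + g + j) = absd p' (s' + g' + j').
  rewrite !inE => hp'; have hpN : p' < s' + g' + t' by lia.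
  have [|p [hp E hin]] := lf p' hpN; first by rewrite !inE; lia.
  have [] := dd _ _ hp hpN E; move: hin; rewrite !inE => hin.
  have [|-> ->] := hdist_branchB j' si' (_ : s' + g' <= p'); first lia.
  case: (ltnP p s) => hps.
    have [-> ->] := hdist_branchA g j si hps.
    by exists p; last split=> //; rewrite ?inE; lia.
  have [|-> ->] := hdist_branchB j si (_ : s + g <= p); first lia.
  by exists p; last split=> //; rewrite ?inE; lia.
split=> //.
  have [|p hp [Ep dp]] := armA 0; first by rewrite inE.
  have [|q hq [Eq dq]] := armA (s' - 1); first by rewrite !inE eqxx orbT.
  (* Distinct ends match distinct ends; the two possible orders are the two alternatives of
     [same_arm]. *)
  have npq : p <> q.
    by move=> E; move: Ep; rewrite E Eq => /inj'; lia.
  move: hp hq; rewrite !inE => /orP[]/eqP Hp /orP[]/eqP Hq; try lia.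
  1-2: move: dp dq; rewrite Hp Hq /absd => dp dq.
    by split; [lia|left; lia].
  by split; [lia|right; lia].
have [|p hp [Ep dp]] := armB (s' + g'); first by rewrite inE eqxx.
have [|q hq [Eq dq]] := armB (s' + g' + t' - 1); first by rewrite !inE eqxx orbT.
have npq : p <> q.
  by move=> E; move: Ep; rewrite E Eq => /inj'; lia.
move: hp hq; rewrite !inE => /orP[]/eqP Hp /orP[]/eqP Hq; try lia.
all: move: dp dq; rewrite Hp Hq /absd => dp dq.
  by split; [lia|left; lia].
by split; [lia|right; lia].
Qed.
End Uniqueness.

(** Both numberings have the same two vertices of degree 3. If these occur in opposite orders, the
    second numbering is swapped first. *)
Lemma hnumbering_params (T : finType) (e : rel T) s g t i j s' g' t' i' j' X X' :
  0 < i < s - 1 -> 0 < j < t - 1 -> i' < s' -> j' < t' ->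
  hnumbering e s g t i j X -> hnumbering e s' g' t' i' j' X' ->
  g = g' /\ (same_arm s i s' i' /\ same_arm t j t' j' \/
             same_arm t j s' i' /\ same_arm s i t' j').
Proof.
move=> hi hj si' tj' hX hX'.
have [si tj] : i < s /\ j < t by lia.
have [inj sur ed] := hX; have [inj' sur' ed'] := hX'.
have [p' hp' E1] := sur' (X i); have [q' hq' E2] := sur' (X (s + g + j)).
have b1 := hnumbering_branch si' tj' hX' hp'.
have b2 := hnumbering_branch si' tj' hX' hq'.
move: b1 b2; rewrite -E1 -E2 (hnumbering_degreeA si tj hX hi).
rewrite (hnumbering_degreeB si tj hX hj) => /(_ isT) b1 /(_ isT) b2.
have npq : p' <> q'.
  by move=> E; move: E1; rewrite E -E2 => /inj; lia.
case: b1 => [[Ep hi']|[Ep hj']]; case: b2 => [[Eq hj'']|[Eq hi'']]; try lia.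
  rewrite Ep in E1; rewrite Eq in E2.
  by have [-> ? ?] := hnumbering_params_aligned hi hj hX hX' hi' hi'' E1 E2; split=> //; left.
have hX'' := hnumbering_swap si' tj' hX'.
have [||||-> h1 h2] := hnumbering_params_aligned hi hj hX hX''; try lia.
- by rewrite E1 Ep; congr X'; lia.
- by rewrite E2 Eq; congr X'; lia.
by split=> //; right; move: h1 h2; rewrite /same_arm; lia.
Qed.

(** * Linear configurations *)

(* Row [l] occupies the positions [off l .. off l + k l - 1], last vertex first. *)
Definition rowedge (n : nat) (k off dl : nat -> nat) (p q : nat) : Prop :=
  (exists l, [/\ l < n, off l <= p, q = p.+1 & q < off l + k l]) \/
  (exists l, [/\ l.+1 < n, p = off l + dl l
               & q = off l.+1 + (k l.+1 - 1 - dl l)]).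

Section Offsets.
Variables (k off : nat -> nat).
Hypothesis offS : forall l, off l.+1 = off l + k l.

Lemma off_mono l m : l <= m -> off l <= off m.
Proof.
elim: m => [|m IH]; first by rewrite leqn0 => /eqP ->.
by rewrite leq_eqVlt => /orP[/eqP->//|/IH]; rewrite offS; lia.
Qed.

Lemma off_find n p : off 0 = 0 -> p < off n ->
  exists l, [/\ l < n, off l <= p & p < off l + k l].
Proof.
move=> off0; elim: n => [|n IH]; first by rewrite off0.
case: (ltnP p (off n)) => [/IH[l [? ? ?]] _|h1 h2]; first by exists l; split=> //; lia.
by exists n; split=> //; rewrite -offS.
Qed.

Lemma off_lt l m : off l < off m -> l < m.
Proof. by move=> h; rewrite ltnNge; apply/negP=> /off_mono; lia. Qed.

Lemma off_const q d m : (forall l, q <= l < q + m -> k l = d) ->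
  forall l, l <= m -> off (q + l) = off q + l * d.
Proof.
move=> kd; elim=> [|l IH] hl; first by rewrite addn0 mul0n addn0.
by rewrite addnS offS IH ?kd; lia.
Qed.
End Offsets.

(** Between rows of equal length [d1] with [dl = d1 - 1], the link joins the last position of one
    row to the first of the next, so each block of equal rows fuses into a run. The link entering
    the bridge rows leaves position [d] of the last [d1] row; the one leaving them reaches position
    [d2 - 1 - d] of the first [d2] row. For [m = 0] these are a single link. *)
Lemma rowedge_hedge (q1 m q2 d1 d d2 : nat) (k off dl : nat -> nat) p q :
  0 < q1 -> 0 < q2 -> d < d1 -> d < d2 ->
  off 0 = 0 -> (forall l, off l.+1 = off l + k l) ->
  (forall l, l < q1 -> k l = d1) ->
  (forall l, q1 <= l < q1 + m -> k l = d.+1) ->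
  (forall l, q1 + m <= l < q1 + m + q2 -> k l = d2) ->
  (forall l, l.+1 < q1 + m + q2 -> dl l =
     if l.+1 < q1 then d1 - 1 else if l.+1 <= q1 + m then d else d2 - 1) ->
  rowedge (q1 + m + q2) k off dl p q <->
  hedge (q1 * d1) (m * d.+1) (q2 * d2) (q1.-1 * d1 + d) (d2 - 1 - d) p q.
Proof.
move=> q1P q2P d1P d2P off0 offS kA kM kB dlE.
have mono := off_mono offS.
have oA l : l <= q1 -> off l = l * d1.
  by move=> hl; rewrite -[l]add0n (off_const offS (d := d1) (m := q1)) ?off0 //.
have o1 : off q1 = q1 * d1 by apply: oA.
have o2 : off (q1 + m) = q1 * d1 + m * d.+1 by rewrite -o1; apply: (off_const offS) kM _ _.
have o3 : off (q1 + m + q2) = q1 * d1 + m * d.+1 + q2 * d2.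
  by rewrite -o2; apply: (off_const offS) kB _ _.
have o0 : off q1.-1 = q1.-1 * d1 by apply: oA; lia.
have oS : off q1 = off q1.-1 + d1 by rewrite -{1}(prednK q1P) offS kA //; lia.
have gE : (m * d.+1 == 0) = (m == 0) by rewrite muln_eq0 orbF.
have gM : 0 < m -> off (q1 + m) = off (q1 + m).-1 + d.+1.
  by move=> mP; rewrite -{1}[q1 + m]prednK ?offS ?kM; lia.
(* Naming the products makes the remaining goals linear. *)
move: (q1 * d1) (m * d.+1) (q2 * d2) (q1.-1 * d1) o0 o1 o2 o3 gE {oA} => s g t i0 o0 o1 o2 o3 gE.
rewrite /rowedge /hedge; split.
  case=> [[l [hl h1 -> h2]]|[l [hl -> ->]]].
    left; split=> //; rewrite -offS in h2.
    case: (ltnP l q1) => h3; first by left; have := mono _ _ h3; lia.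
    case: (ltnP l (q1 + m)) => h4; right; [left|right].
      by have := mono _ _ h3; have := mono _ _ h4; lia.
    by have := mono _ _ h4; have := mono _ _ hl; lia.
  rewrite (dlE _ hl); case: ltnP => h1.
    left; rewrite kA // offS kA; last lia.
    by have := mono _ _ h1; rewrite !offS !kA; lia.
  case: (ltngtP q1 l.+1) h1 => // h1 _; last first.
    rewrite -h1 leq_addr; right; have -> : l = q1.-1 by lia.
    rewrite o0; case: (posnP m) => mP.
      by left; rewrite kB; lia.
    by right; left; rewrite kM; lia.
  case: (ltngtP l.+1 (q1 + m)) => h2.
  - left; have := mono _ _ h2; have := mono q1 l; rewrite !offS !kM; lia.
  - left; have := mono (q1 + m) l; have := mono _ _ hl; rewrite !offS !kB; lia.
  - right; right; right; have El : l = (q1 + m).-1 by lia.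
    by rewrite h2 o2 kB ?El; lia.
(* Converse for one block: two consecutive positions either share a row, or end one row and begin
   the next, where the link joins them. *)
have row a b d' : (forall l, off a <= off l < off b -> k l = d') ->
    off b <= off (q1 + m + q2) ->
    (forall l, off a <= off l -> off l.+1 < off b ->
       dl l = d' - 1 /\ l.+1 < q1 + m + q2 /\ 0 < d') ->
    a <= b -> off a <= p -> p.+1 < off b ->
    rowedge (q1 + m + q2) k off dl p p.+1.
  move=> kd hb hd hab h1 h2.
  have [l [hl hlp hpl]] := off_find offS off0 (ltnW h2).
  have hla : a <= l by have := @off_lt _ _ offS a l.+1; rewrite offS; lia.
  have kl : k l = d' by apply: kd; rewrite mono //; lia.
  have [h3|h3] := ltnP p.+1 (off l + k l).
    left; exists l; split=> //; have := mono _ _ (ltnW hl).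
    by have := @off_lt _ _ offS l (q1 + m + q2); lia.
  right; exists l; have E : off l.+1 = p.+1 by rewrite offS; lia.
  have [||-> [hln dP]] := hd l; [by rewrite mono| by rewrite E|].
  split=> //; first lia.
  by rewrite E kd; rewrite ?E ?mono; lia.
case=> [[-> [h|[[h1 h2]|[h1 h2]]]]|[[g0 [-> ->]]|[[gP [-> ->]]|[gP [-> ->]]]]].
- apply: (row 0 q1 d1); rewrite ?off0 ?o1 ?mono //; try lia.
    by move=> l /andP[_]; rewrite -o1 => /(off_lt offS)/kA.
  by move=> l _; rewrite -o1 => /(off_lt offS) h3; rewrite dlE ?h3; lia.
- apply: (row q1 (q1 + m) d.+1); rewrite ?o1 ?o2 ?mono //; try lia.
    move=> l /andP[h3]; rewrite -o2 => /(off_lt offS) h4; apply: kM.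
    rewrite h4 andbT leqNgt; apply/negP=> h5; have := mono _ _ h5; rewrite offS kA //.
    lia.
  move=> l h3; rewrite -o2 => /(off_lt offS) h4.
  have h5 : q1 <= l.
    by rewrite leqNgt; apply/negP=> h5; have := mono _ _ h5; rewrite offS kA //; lia.
  by rewrite dlE; [do ?case: ifP => ?; lia|lia].
- apply: (row (q1 + m) (q1 + m + q2) d2); rewrite ?o2 ?o3 ?mono //; try lia.
    move=> l /andP[h3]; rewrite -o3 => /(off_lt offS) h4; apply: kB.
    rewrite h4 andbT leqNgt; apply/negP=> h5; have := mono _ _ h5; rewrite offS.
    have [h6|h6] := ltnP l q1; first by rewrite kA; lia.
    by rewrite kM; lia.
  move=> l h3; rewrite -o3 => /(off_lt offS) h4.
  have h5 : q1 + m <= l.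
    rewrite leqNgt; apply/negP=> h5; have := mono _ _ h5; rewrite offS.
    have [h6|h6] := ltnP l q1; first by rewrite kA; lia.
    by rewrite kM; lia.
  by rewrite dlE; [do ?case: ifP => ?; lia|lia].
- right; exists q1.-1; rewrite prednK //; have m0 : m = 0 by lia.
  by rewrite kB ?dlE ?prednK ?ltnn; try lia; do ?case: ifP => ?; split; lia.
- right; exists q1.-1; rewrite prednK //.
  by rewrite kM ?dlE ?prednK ?ltnn; try lia; do ?case: ifP => ?; split; lia.
- right; exists (q1 + m).-1; have mP : 0 < m by lia.
  rewrite prednK ?kB ?dlE ?prednK; try lia.
  by do ?case: ifP => ?; split; lia.
Qed.

Definition offset (k : nat -> nat) (l : nat) := \sum_(i < l) k i.

Lemma offset0 k : offset k 0 = 0.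
Proof. by rewrite /offset big_ord0. Qed.

Lemma offsetS k l : offset k l.+1 = offset k l + k l.
Proof. by rewrite /offset big_ord_recr. Qed.

Lemma size_flatten_offset (T : Type) (Z : seq (seq T)) :
  size (flatten Z) = offset (fun l => size (nth [::] Z l)) (size Z).
Proof.
elim: Z => [|z Z IH] /=; first by rewrite offset0.
by rewrite size_cat IH /offset big_ord_recl.
Qed.

Lemma nth_flatten_offset (T : Type) (x0 : T) (Z : seq (seq T)) l c :
  l < size Z -> c < size (nth [::] Z l) ->
  nth x0 (flatten Z) (offset (fun l => size (nth [::] Z l)) l + c) =
  nth x0 (nth [::] Z l) c.
Proof.
elim: Z l => [|z Z IH] [|l] //= hl hc.
  by rewrite offset0 nth_cat hc.
rewrite /offset big_ord_recl /= -addnA nth_cat ltnNge leq_addr /= addKn.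
exact: IH.
Qed.

(** * From a linear configuration to a numbering by rows *)

Section ConfigurationRows.
Variables (T : finType) (e : rel T) (C : seq (seq T)) (x0 : T).
Hypotheses (treee : treelike e) (lcC : linear_configuration e C).
Hypothesis C_gt1 : 1 < size C.

Let n := size C.
Let row l := nth [::] C l.
Let k l := size (row l).
Let off := offset k.
Let X p := nth x0 (flatten (map rev C)) p.
Let N := off n.

Let offS l : off l.+1 = off l + k l.
Proof. exact: offsetS. Qed.

Let mono := off_mono offS.

Let sizeZ : size (flatten (map rev C)) = N.
Proof.
rewrite size_flatten_offset size_map; apply: eq_bigr => l _.
by rewrite (nth_map [::]) // size_rev.
Qed.

Let XE l c : l < n -> c < k l -> X (off l + c) = nth x0 (row l) (k l - c.+1).
Proof.
move=> hl hc.
have E : offset (fun l => size (nth [::] (map rev C) l)) l = off l.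
  apply: eq_bigr => l' _; have hl' := ltn_ord l'.
  by rewrite (nth_map [::]) ?size_rev //; apply: ltn_trans hl.
rewrite /X -E nth_flatten_offset ?size_map // (nth_map [::]) // ?size_rev //.
by rewrite nth_rev.
Qed.

Let rowE x1 l i : l < n -> i < k l -> nth x1 (row l) i = X (off l + (k l - i.+1)).
Proof.
move=> hl hi; rewrite XE //; last lia.
by rewrite (set_nth_default x0) //; congr nth; lia.
Qed.

Let perm : perm_eq (flatten (map rev C)) (enum T).
Proof.
case: lcC => _ pC _ _; apply: perm_trans pC.
elim: (C) => //= P C' IH; apply: perm_cat => //.
by rewrite perm_rev.
Qed.

Let inj p q : p < N -> q < N -> X p = X q -> p = q.
Proof.
move=> hp hq /eqP; rewrite nth_uniq ?sizeZ //; first by move/eqP.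
by rewrite (perm_uniq perm) enum_uniq.
Qed.

Let sur x : exists2 p, p < N & x = X p.
Proof.
have : x \in flatten (map rev C) by rewrite (perm_mem perm) mem_enum.
by case/(nthP x0) => p; rewrite sizeZ => hp <-; exists p.
Qed.

Let k_gt0 l : l < n -> 0 < k l.
Proof.
move=> hl; case: lcC => nC _ _ _; rewrite lt0n; apply/negP=> /nilP E.
by move/negP: nC; apply; rewrite -E mem_nth.
Qed.

Let pos_lt l c : l < n -> c < k l -> off l + c < N.
Proof. by move=> hl hc; have := mono hl; rewrite offS /N; lia. Qed.

Let row_step l c : l < n -> c.+1 < k l ->
  e (X (off l + c)) (X (off l + c.+1)).
Proof.
move=> hl hc; case: treee => sym _ _ _ _; case: lcC => _ _ so _.
have /(sortedP x0) /(_ (k l - c.+2)) := so (row l) (mem_nth _ hl).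
rewrite -/(k l) !rowE //; try lia.
rewrite sym => /(_ _); have -> : k l - (k l - c.+2).+2 = c by lia.
by have -> : k l - (k l - c.+2).+1 = c.+1; [lia|apply; lia].
Qed.

Let row_dist l c c' : l < n -> c <= c' -> c' < k l ->
  dist e (X (off l + c)) (X (off l + c')) = c' - c /\
  dist e (X (off l + c')) (X (off l + c)) = c' - c.
Proof.
move=> hl; apply: (@treelike_path_dist _ _ (fun c => X (off l + c)) (k l)) => //.
  by move=> c1 /(row_step hl).
move=> c1 c2 h1 h2 /inj E; have := E (pos_lt hl h1) (pos_lt hl h2); lia.
Qed.

(** [d] is the common distance in the definition of a linear configuration: in reversed rows,
    position [d] is at distance [d] from the last vertex, and position [k - 1 - d] at distance [d]
    from the first. *)
Let link l d := [&& 0 < d, d < k l, d < k l.+1 &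
  e (X (off l + d)) (X (off l.+1 + (k l.+1 - 1 - d)))].

(** Rows are geodesics, so the two distances are the index differences [k l - i.+1] and [j]; as
    indices start at 0, [j] itself is the witness. *)
Let link_edgeE l x y : l.+1 < n -> link_edge e (row l) (row l.+1) x y ->
  exists2 d, [&& 0 < d, d < k l & d < k l.+1] &
    x = X (off l + d) /\ y = X (off l.+1 + (k l.+1 - 1 - d)).
Proof.
move=> hl [i [j [hi hj Ex Ey dE]]]; have hl' := ltnW hl.
have Ed : last x (row l) = X (off l + 0).
  by rewrite -nth_last rowE -/(k l) //; [congr (X (_ + _))|]; have := k_gt0 hl'; lia.
have Eh : head y (row l.+1) = X (off l.+1 + (k l.+1 - 1)).
  by rewrite -nth0 rowE //; exact: k_gt0.
have {}Ex : x = X (off l + (k l - i.+1)) by rewrite {1}Ex rowE.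
have {}Ey : y = X (off l.+1 + (k l.+1 - j.+1)).
  by rewrite {1}Ey rowE //; case/andP: hj.
move: dE; rewrite Ed Eh {1}Ex {1}Ey.
have [_ ->] := @row_dist l 0 (k l - i.+1) hl' isT ltac:(rewrite /k; lia).
have [_ ->] := @row_dist l.+1 (k l.+1 - j.+1) (k l.+1 - 1) hl
  ltac:(lia) ltac:(move: hj; rewrite /k; lia).
move=> E; exists j; first by move: hi hj E; rewrite -/(k l) -/(k l.+1); lia.
rewrite Ex Ey; split; congr (X (_ + _)); move: hi hj E; rewrite -/(k l) -/(k l.+1); lia.
Qed.

(** A provisional [rowedge], before the link between two rows is known to be unique. *)
Let cedge p q := (exists l, [/\ l < n, off l <= p, q = p.+1 & q < off l.+1]) \/
  (exists l d, [/\ l.+1 < n, link l d, p = off l + d &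
     q = off l.+1 + (k l.+1 - 1 - d)]).

Let edgeE p q : p < N -> q < N -> e (X p) (X q) -> cedge p q \/ cedge q p.
Proof.
move=> hp hq epq; case: (treee) => sym _ _ _ _; case: (lcC) => _ _ _ lk.
case: (boolP (has (fun P => path_edge P (X p) (X q)) C)) => [/hasP[P PC]|nP].
  case/(nthP [::]): PC => l hl <- /(path_edgeP x0)[c hc].
  rewrite -/(row l) !rowE //; last exact: ltnW.
  rewrite -/(row l) -/(k l) in hc.
  have h1 := @pos_lt l (k l - c.+1) hl ltac:(lia).
  have h2 := @pos_lt l (k l - c.+2) hl ltac:(lia).
  case=> -[/inj-/(_ _ _)Ep /inj-/(_ _ _)Eq].
    right; left; exists l; rewrite offS Ep // Eq //; split=> //; lia.
  left; left; exists l; rewrite offS Ep // Eq //; split=> //; lia.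
have [l hl [/(link_edgeE hl)|/(link_edgeE hl)]] := lk _ _ epq nP;
  case=> d hd [Ep Eq].
  left; right; exists l, d; rewrite /link -Ep -Eq epq; split=> //; try by rewrite andbT.
  + by apply: inj => //; apply: pos_lt; lia.
  + by apply: inj => //; apply: pos_lt; lia.
right; right; exists l, d; rewrite /link -Ep -Eq sym epq; split=> //; try by rewrite andbT.
+ by apply: inj => //; apply: pos_lt; lia.
+ by apply: inj => //; apply: pos_lt; lia.
Qed.

(** Links join only consecutive rows. Without a link from row [l], the vertices of rows 0 to [l]
    would be closed under adjacency, against connectedness. *)
Let link_ex l : l.+1 < n -> exists d, link l d.
Proof.
move=> hl; case: (boolP (has (link l) (iota 0 (k l)))) => [/hasP[d _ hd]|/hasPn nl].
  by exists d.
have oN : off l.+1 < N by have := pos_lt hl (k_gt0 hl); lia.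
have S0 : exists2 p, p < off l.+1 & X 0 = X p.
  by exists 0 => //; rewrite offS; have := k_gt0 (ltnW hl); lia.
have [|p hp /inj E] := treelike_connected
  (S := fun x => exists2 p, p < off l.+1 & x = X p) treee S0 _ (X (off l.+1)).
  move=> x z [p hp ->]; have [q hq ->] := sur z => epq; exists q => //.
  rewrite ltnNge; apply/negP=> hlq.
  have [] := edgeE _ hq epq; first lia.
  + case=> [[l' [hl' h1 Eq h2]]|[l' [d [hl' hd Ep Eq]]]].
      have := @off_lt _ _ offS l' l.+1; have := @off_lt _ _ offS l.+1 l'.+1; lia.
    have /and4P[d0 d1 d2 _] := hd.
    have h1 := @off_lt _ _ offS l' l.+1 ltac:(lia).
    have h2 := @off_lt _ _ offS l.+1 l'.+2 ltac:(rewrite (offS l'.+1); lia).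
    have El : l' = l by lia.
    by rewrite El in hd d1; move: (nl d); rewrite mem_iota hd add0n d1 => /(_ isT).
  + case=> [[l' [hl' h1 Eq h2]]|[l' [d [hl' hd Ep Eq]]]]; first lia.
    by have /and4P[d0 d1 d2 _] := hd; rewrite offS in Eq; lia.
by have := E oN; lia.
Qed.

(** Two links would close a cycle. With [h = d' - d], a walk along row [l], across the first link
    and along row [l + 1] never turns back and has length [2h + 1], yet the second link puts its
    ends at distance 1. *)
Let link_uniq l d d' : l.+1 < n -> link l d -> link l d' -> d = d'.
Proof.
move=> hl; wlog: d d' / d < d'.
  move=> W h h'; case: (ltngtP d d') => // hd; first exact: W.
  by symmetry; apply: W.
move=> hdd /and4P[d0 d1 d2 e1] /and4P[d0' d1' d2' e2].
case: (treee) => sym dst0 step _ _; have hl' := ltnW hl.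
pose h := d' - d.
(* The walk: from [d'] down to [d] in row [l], then from [k l.+1 - 1 - d] down to [k l.+1 - 1 - d']
   in row [l + 1]. *)
pose g i := if i <= h then off l + (d' - i)
            else off l.+1 + (k l.+1 - 1 - d - (i - h.+1)).
have gA i : i <= h -> g i = off l + (d' - i) by rewrite /g => ->.
have gB i : h < i -> g i = off l.+1 + (k l.+1 - 1 - d - (i - h.+1)).
  by move=> hi; rewrite /g leqNgt hi.
have gN i : g i < N.
  by rewrite /g; case: ifP => ?; apply: pos_lt => //; lia.
have := @treelike_walk_dist _ e (fun i => X (g i)) (h + h).+1 treee.
have gl : g (h + h).+1 = off l.+1 + (k l.+1 - 1 - d').
  by rewrite gB; [congr addn; rewrite /h; lia|lia].
have g0 : g 0 = off l + d' by rewrite gA ?subn0.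
rewrite gl g0; case: (step (X (off l + d')) _ _ e2); rewrite dst0 // => -> H.
suff : 1 = (h + h).+1 by rewrite /h; lia.
apply: H => [i hi|i hi /inj-/(_ (gN _) (gN _))].
  case: (ltngtP i h) => hih.
  - rewrite !gA; try lia.
    have -> : d' - i = (d' - i.+1).+1 by rewrite /h in hih; lia.
    by rewrite sym; apply: row_step; lia.
  - rewrite !gB; try lia.
    have -> : k l.+1 - 1 - d - (i - h.+1) = (k l.+1 - 1 - d - (i.+1 - h.+1)).+1.
      by rewrite /h in hih hi *; lia.
    by rewrite sym; apply: row_step; lia.
  - rewrite gA ?gB; try lia.
    rewrite hih subnn subn0; have -> : d' - h = d by rewrite /h; lia.
    by [].
rewrite /g; do 2!case: ifP => ?; rewrite ?offS /h in hi *; lia.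
Qed.

Lemma configuration_numbering : exists k' off' dl X',
  [/\ off' 0 = 0, forall l, off' l.+1 = off' l + k' l,
      forall l, l.+1 < n -> [/\ 0 < dl l, dl l < k' l & dl l < k' l.+1],
      numbering e (off' n) (rowedge n k' off' dl) X'
    & forall l x, l < n -> x \in nth [::] C l ->
        exists2 c, c < k' l & x = X' (off' l + c)].
Proof.
(* The implication lets a value be chosen for every [l], also where no next row exists. *)
have dlP l : exists d, (l.+1 < n) ==> link l d.
  case: (ltnP l.+1 n) => [/link_ex[d hd]|_]; last by exists 0.
  by exists d.
pose dl l := xchoose (dlP l).
have dlE l : l.+1 < n -> link l (dl l).
  by move=> hl; apply: (implyP (xchooseP (dlP l))).
exists k, off, dl, X; split=> //.
- exact: offset0.
- by move=> l /dlE/and4P[? ? ? _].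
- split=> // p q hp hq; split.
    have rE p' q' : cedge p' q' -> rowedge n k off dl p' q'.
      case=> [[l [h1 h2 h3 h4]]|[l [d [hl hd Ep Eq]]]].
        by left; exists l; rewrite -offS.
      by right; exists l; rewrite -(link_uniq hl hd (dlE _ hl)).
    by case/edgeE => // h; [left|right]; apply: rE.
  case: (treee) => sym _ _ _ _.
  have rE p' q' : rowedge n k off dl p' q' -> e (X p') (X q').
    case=> [[l [h1 h2 -> h4]]|[l [hl -> ->]]].
      have -> : p' = off l + (p' - off l) by lia.
      by rewrite -addnS; apply: row_step => //; lia.
    by case/and4P: (dlE _ hl).
  by case=> /rE //; rewrite sym.
- move=> l x hl /(nthP x0)[i hi <-]; exists (k l - i.+1).
    by rewrite ltn_subrL k_gt0.
  by rewrite -/(row l) rowE.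
Qed.
End ConfigurationRows.

(** * Row lengths forced by the two branch vertices *)

Lemma const_run (k : nat -> nat) a b :
  (forall x, a <= x < b -> k x.+1 = k x) -> forall x, a <= x <= b -> k x = k a.
Proof.
move=> H; elim=> [|x IH] hx; first by congr k; lia.
by case: (eqVneq a x.+1) => [->//|hax]; rewrite H ?IH; lia.
Qed.

Section RowShape.
Variables (T : finType) (e : rel T) (n : nat) (k off dl : nat -> nat) (X : nat -> T).
Hypotheses (off0 : off 0 = 0) (offS : forall l, off l.+1 = off l + k l).
Hypothesis dlP : forall l, l.+1 < n -> [/\ 0 < dl l, dl l < k l & dl l < k l.+1].
Hypothesis hX : numbering e (off n) (rowedge n k off dl) X.
Hypothesis deg3 : forall x, degree e x <= 3.
Variables (l m : nat) (w1 w2 : T).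
Hypotheses (m_gt0 : 0 < m) (lm : l + m < n).
Hypothesis branch : forall x, 2 < degree e x -> x = w1 \/ x = w2.
Variables (c1 c1' c2 c2' : nat).
Hypotheses (w1E : w1 = X (off l + c1)) (c1k : c1 < k l).
Hypotheses (c1k' : c1' < k l.+1) (ew1 : e w1 (X (off l.+1 + c1'))).
Hypotheses (w2E : w2 = X (off (l + m) + c2)) (c2k : c2 < k (l + m)).
Hypotheses (c2k' : c2' < k (l + m - 1)) (ew2 : e w2 (X (off (l + m - 1) + c2'))).

Let mono := off_mono offS.
(** [up g] and [low g] are the ends of link [g], in rows [g] and [g + 1]. *)
Let up g := off g + dl g.
Let low g := off g.+1 + (k g.+1 - 1 - dl g).

Let pos_lt g c : g < n -> c < k g -> off g + c < off n.
Proof. by move=> hg hc; have := mono hg; rewrite offS; lia. Qed.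

Let row_uniq g g' c c' : c < k g -> c' < k g' -> off g + c = off g' + c' -> g = g'.
Proof.
move=> hc hc' E; case: (ltngtP g g') => // h; have := mono h; rewrite offS; lia.
Qed.

(** Row edges and all other links stay on one side of [off g.+1]. This locates [w1] and [w2] at ends
    of the links [l] and [l + m - 1]. *)
Let cross g p q : p < off g.+1 -> off g.+1 <= q -> g.+1 < n ->
  rowedge n k off dl p q \/ rowedge n k off dl q p -> p = up g /\ q = low g.
Proof.
move=> hp hq hg; case; case=> [[g' [hg' h1 h2 h3]]|[g' [hg' h1 h2]]].
- have := @off_lt _ _ offS g' g.+1; have := @off_lt _ _ offS g.+1 g'.+1.
  by rewrite (offS g'); lia.
- have [d0 d1 d2] := dlP hg'.
  have := @off_lt _ _ offS g' g.+1; have := @off_lt _ _ offS g.+1 g'.+2.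
  rewrite (offS g'.+1) => h3 h4; have E : g' = g by lia.
  by rewrite E in h1 h2.
- by lia.
- by have [d0 d1 d2] := dlP hg'; rewrite offS in h2; lia.
Qed.

Let l_lt : l.+1 < n. Proof. lia. Qed.
Let lm_pred : (l + m - 1).+1 = l + m. Proof. lia. Qed.
Let lm_lt : (l + m - 1).+1 < n. Proof. by rewrite lm_pred. Qed.

Let up_lt g : g.+1 < n -> up g < off n.
Proof. by move=> hg; have [? ? ?] := dlP hg; apply: pos_lt => //; lia. Qed.

Let low_lt g : g.+1 < n -> low g < off n.
Proof. by move=> hg; have [? ? ?] := dlP hg; apply: pos_lt => //; lia. Qed.

Let w1_up : w1 = X (up l).
Proof.
have [inj sur ed] := hX; move: ew1; rewrite w1E.
move/ed=> /(_ _ _)H; have [||||->//] := @cross l (off l + c1) (off l.+1 + c1').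
- by rewrite offS; lia.
- by lia.
- by [].
- by apply: H; apply: pos_lt => //; lia.
Qed.

Let w2_low : w2 = X (low (l + m - 1)).
Proof.
have [inj sur ed] := hX; move: ew2; rewrite w2E.
move/ed=> /(_ _ _)H.
have [||||_ <-] := @cross (l + m - 1) (off (l + m - 1) + c2') (off (l + m) + c2).
- by rewrite offS; lia.
- by rewrite lm_pred; lia.
- by [].
- by apply/or_comm; apply: H; apply: pos_lt => //; lia.
by [].
Qed.

Let rowedge_row g c : g < n -> c.+1 < k g ->
  rowedge n k off dl (off g + c) (off g + c.+1).
Proof. by move=> hg hc; left; exists g; split=> //; lia. Qed.

Let rowedge_link g : g.+1 < n -> rowedge n k off dl (up g) (low g).
Proof. by move=> hg; right; exists g. Qed.

(** Such a vertex would have four neighbours: two in its row and one along each link. *)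
Let both_links g : g.+2 < n -> up g.+1 = low g -> (dl g.+1).+1 < k g.+1 -> False.
Proof.
move=> hg E hd; have hg' := ltnW hg.
have [d0 d1 d2] := dlP hg; have [d0' d1' d2'] := dlP hg'.
have [inj sur ed] := hX.
have h1 : off g.+1 + (dl g.+1).-1 < off n by apply: pos_lt => //; lia.
have h2 : off g.+1 + (dl g.+1).+1 < off n by apply: pos_lt => //; lia.
have hu := up_lt hg; have hu' := up_lt hg'; have hl := low_lt hg.
have := deg3 (X (up g.+1)); rewrite leqNgt => /negP; apply; apply/card_geqP.
pose ps := [:: up g; off g.+1 + (dl g.+1).-1; off g.+1 + (dl g.+1).+1; low g.+1].
have psN p : p \in ps -> p < off n.
  by rewrite !inE => /or4P[] /eqP ->.
exists (map X ps); split=> //.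
  rewrite map_inj_in_uniq => [|p q /psN hp /psN hq]; last exact: inj.
  by rewrite /= !inE /up /low !offS; lia.
move=> x /mapP[p hp ->]; rewrite inE; apply/ed=> //; first exact: psN.
move: hp; rewrite !inE => /or4P[] /eqP ->.
- by right; rewrite E; apply: rowedge_link.
- right; have := @rowedge_row g.+1 (dl g.+1).-1 hg'; rewrite prednK //; apply; lia.
- by left; apply: rowedge_row.
- by left; apply: rowedge_link.
Qed.

(** A link leaving from inside a row creates a vertex of degree 3, hence [w1] or [w2]. At [w2] it
    would meet the link entering from the previous row, which [both_links] excludes. *)
Let up_branch g : g.+1 < n -> (dl g).+1 < k g -> g = l.
Proof.
move=> hg hd; have [inj sur ed] := hX; have [d0 d1 d2] := dlP hg.
have hg' := ltnW hg.
have /branch : 2 < degree e (X (up g)).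
  apply: (numbering_degree_gt2 (q1 := off g + (dl g).-1)
     (q2 := off g + (dl g).+1) (q3 := low g) hX).
  - exact: up_lt.
  - by apply: pos_lt => //; lia.
  - by apply: pos_lt => //; lia.
  - exact: low_lt.
  - by right; have := @rowedge_row g (dl g).-1 hg'; rewrite prednK //; apply; lia.
  - by left; apply: rowedge_row.
  - by left; apply: rowedge_link.
  - by lia.
  - by rewrite /low offS; lia.
  - by rewrite /low offS; lia.
case; [rewrite w1_up|rewrite w2_low] => /inj E.
  have := E (up_lt hg) (up_lt l_lt).
  by have [? ? ?] := dlP l_lt; apply: row_uniq.
have {}E := E (up_lt hg) (low_lt lm_lt).
have [? ? ?] := dlP lm_lt.
have El : g = (l + m - 1).+1 by apply: row_uniq E => //; lia.
by rewrite El in E hd hg; case: (both_links hg E).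
Qed.

Let low_branch g : g.+1 < n -> (dl g).+1 < k g.+1 -> g.+1 = l + m.
Proof.
move=> hg hd; have [inj sur ed] := hX; have [d0 d1 d2] := dlP hg.
have lE : low g = off g.+1 + (k g.+1 - 1 - dl g).-1.+1 by rewrite /low; lia.
have lE' : low g = off g.+1 + (k g.+1 - 1 - dl g) by [].
have /branch : 2 < degree e (X (low g)).
  apply: (numbering_degree_gt2 (q1 := off g.+1 + (k g.+1 - 1 - dl g).-1)
     (q2 := off g.+1 + (k g.+1 - 1 - dl g).+1) (q3 := up g) hX).
  - exact: low_lt.
  - by apply: pos_lt => //; lia.
  - by apply: pos_lt => //; lia.
  - exact: up_lt.
  - by right; rewrite lE; apply: rowedge_row => //; lia.
  - by left; rewrite lE'; apply: rowedge_row => //; lia.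
  - by right; apply: rowedge_link.
  - by lia.
  - by rewrite /up offS; lia.
  - by rewrite /up offS; lia.
case; [rewrite w1_up|rewrite w2_low] => /inj E.
  have {}E := E (low_lt hg) (up_lt l_lt).
  have [? ? ?] := dlP l_lt.
  have El : g.+1 = l by apply: row_uniq E => //; lia.
  have hl := l_lt; rewrite -El in hl E.
  by case: (both_links hl (esym E)); move: E; rewrite /up /low; lia.
have {}E := E (low_lt hg) (low_lt lm_lt).
by have [? ? ?] := dlP lm_lt; rewrite -[RHS]lm_pred; apply: row_uniq E; lia.
Qed.

(** Apart from the upper end of link [l] and the lower end of link [l + m - 1], every link sits at
    an end of its row, which gives [k = dl + 1] there. So lengths can change only after row [l] and
    before row [l + m]. *)
Lemma rows_shape : exists q1 m1 q2 d1 d d2,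
  [/\ (0 < q1 /\ 0 < q2), 0 < d, (d < d1 /\ d < d2)
    & hnumbering e (q1 * d1) (m1 * d.+1) (q2 * d2) (q1.-1 * d1 + d) (d2 - 1 - d) X].
Proof.
have upE g : g.+1 < n -> g <> l -> k g = (dl g).+1.
  by move=> hg hgl; have [? ? ?] := dlP hg; case: (ltnP (dl g).+1 (k g)) => [/up_branch|]; lia.
have lowE g : g.+1 < n -> g.+1 <> l + m -> k g.+1 = (dl g).+1.
  by move=> hg hgl; have [? ? ?] := dlP hg; case: (ltnP (dl g).+1 (k g.+1)) => [/low_branch|]; lia.
have step g : g.+1 < n -> g <> l -> g.+1 <> l + m -> k g.+1 = k g.
  by move=> h1 h2 h3; rewrite lowE // (upE g).
have kA g : g < l.+1 -> k g = k l.
  have H : forall x, 0 <= x <= l -> k x = k 0.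
    by apply: const_run => x hx; apply: step; lia.
  by move=> hg; rewrite H // [RHS]H ?leqnn.
have kB g : l + m <= g < n -> k g = k (l + m).
  move=> hg; apply: (@const_run k (l + m) n.-1); last lia.
  by move=> x hx; apply: step; lia.
have kM g : l.+1 <= g < l + m -> k g = (dl l).+1.
  move=> hg; rewrite (@const_run k l.+1 (l + m - 1)) ?lowE //; try lia.
  by move=> x hx; apply: step; lia.
have dM g : l <= g < l + m -> dl g = dl l.
  move=> hg; case: (eqVneq g l) => [->//|/eqP hgl].
  by have := upE g; rewrite kM; lia.
have [d0 d1 d2] := dlP l_lt; have [_ _ d3] := dlP lm_lt.
have d2P : dl l < k (l + m).
  by move: d3; rewrite lm_pred dM //; lia.
have nE : n = l.+1 + (m - 1) + (n - (l + m)) by lia.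
(* Rows 0 to [l] form the first arm, the [m - 1] rows strictly between [l] and [l + m] the inner
   bridge, the rest the second arm; bridge rows have length [dl l + 1]. *)
exists l.+1, (m - 1), (n - (l + m)), (k l), (dl l), (k (l + m)); split=> //.
  by split=> //; lia.
have E p q := @rowedge_hedge l.+1 (m - 1) (n - (l + m)) (k l) (dl l) (k (l + m)) k off dl p q.
have {}E p q : rowedge n k off dl p q <->
    hedge (l.+1 * k l) ((m - 1) * (dl l).+1) ((n - (l + m)) * k (l + m))
      (l * k l + dl l) (k (l + m) - 1 - dl l) p q.
  rewrite {1}nE; apply: E => //; try lia.
  - by move=> g hg; apply: kM; lia.
  - by move=> g hg; apply: kB; lia.
  move=> g hg; case: ltnP => h1.
    by rewrite -(kA g) ?(upE g); lia.
  case: ifP => h2; first by apply: dM; lia.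
  by rewrite -(kB g) ?(upE g); lia.
have NE : off n = l.+1 * k l + (m - 1) * (dl l).+1 + (n - (l + m)) * k (l + m).
  have o1 : off l.+1 = l.+1 * k l.
    have := off_const offS (q := 0) (m := l.+1) (d := k l) _ (leqnn _).
    by rewrite add0n off0; apply=> g hg; apply: kA; lia.
  have o2 : off (l.+1 + (m - 1)) = off l.+1 + (m - 1) * (dl l).+1.
    by apply: (off_const offS (m := m - 1)) => // g hg; apply: kM; lia.
  rewrite -o1 -o2 {1}nE.
  by apply: (off_const offS (m := n - (l + m))) => // g hg; apply: kB; lia.
have [inj sur ed] := hX; rewrite /hnumbering -NE; split=> // p q hp hq.
by rewrite ed // !E.
Qed.
End RowShape.

(** * From rows back to a linear configuration *)

Section RowsToConfiguration.
Variables (T : finType) (e : rel T) (n : nat) (k off dl : nat -> nat) (X : nat -> T).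
Hypotheses (off0 : off 0 = 0) (offS : forall l, off l.+1 = off l + k l).
Hypothesis k_gt0 : forall l, l < n -> 0 < k l.
Hypothesis dlP : forall l, l.+1 < n -> [/\ 0 < dl l, dl l < k l & dl l < k l.+1].
Hypothesis hX : numbering e (off n) (rowedge n k off dl) X.
Hypothesis treee : treelike e.

Definition config_row l := rev [seq X p | p <- iota (off l) (k l)].

Let mono := off_mono offS.

Lemma size_config_row l : size (config_row l) = k l.
Proof. by rewrite size_rev size_map size_iota. Qed.

Lemma nth_config_row x0 l i : i < k l ->
  nth x0 (config_row l) i = X (off l + (k l - i.+1)).
Proof.
move=> hi; rewrite nth_rev size_map size_iota // (nth_map 0) ?nth_iota //.
  by lia.
by rewrite size_iota; lia.
Qed.

Lemma mem_config_row l c : c < k l -> X (off l + c) \in config_row l.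
Proof.
move=> hc; rewrite mem_rev; apply: map_f.
by rewrite mem_iota; lia.
Qed.

Let pos_lt l c : l < n -> c < k l -> off l + c < off n.
Proof. by move=> hl hc; have := mono hl; rewrite offS; lia. Qed.

Let row_step l c : l < n -> c.+1 < k l ->
  e (X (off l + c)) (X (off l + c.+1)).
Proof.
move=> hl hc; have [_ _ ed] := hX; apply/ed; try by apply: pos_lt => //; lia.
by left; left; exists l; split=> //; lia.
Qed.

Let row_dist l c c' : l < n -> c <= c' -> c' < k l ->
  dist e (X (off l + c)) (X (off l + c')) = c' - c /\
  dist e (X (off l + c')) (X (off l + c)) = c' - c.
Proof.
have [inj _ _] := hX.
move=> hl; apply: (@treelike_path_dist _ _ (fun c => X (off l + c)) (k l)) => //.
  by move=> c1 /(row_step hl).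
move=> c1 c2 h1 h2 /inj E; have := E (pos_lt hl h1) (pos_lt hl h2); lia.
Qed.

Let perm_rows m : perm_eq (flatten (mkseq config_row m)) [seq X p | p <- iota 0 (off m)].
Proof.
elim: m => [|m IH]; first by rewrite off0.
rewrite mkseqS flatten_rcons offS iotaD map_cat add0n.
by apply: perm_cat => //; rewrite perm_rev.
Qed.

Lemma rows_linear_configuration : linear_configuration e (mkseq config_row n).
Proof.
case: (treee) => sym _ _ _ _; have [inj sur ed] := hX; split.
- apply/negP=> /mapP[l]; rewrite mem_iota => hl /(congr1 size).
  by rewrite size_config_row /= => E; have := k_gt0 (l := l); lia.
- exact: perm_trans (perm_rows n) (numbering_perm hX).
- move=> P /mapP[l]; rewrite mem_iota => hl ->; apply/(sortedP (X 0)) => i.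
  rewrite size_config_row => hi; rewrite !nth_config_row; try lia.
  rewrite sym; have -> : k l - i.+1 = (k l - i.+2).+1 by lia.
  by apply: row_step; lia.
have key p q : p < off n -> q < off n -> rowedge n k off dl p q ->
    has (fun P => path_edge P (X p) (X q)) (mkseq config_row n) \/
    exists2 l, l.+1 < n & link_edge e (config_row l) (config_row l.+1) (X p) (X q).
  move=> hp hq [[l [hl h1 -> h2]]|[l [hl -> ->]]].
    left; apply/hasP; exists (config_row l); first by apply: map_f; rewrite mem_iota; lia.
    apply/(path_edgeP (X 0)); exists (off l + k l - p.+2); rewrite ?size_config_row; first lia.
    by right; rewrite !nth_config_row; try lia; split; congr X; lia.
  right; exists l => //; have [d0 d1 d2] := dlP hl; have hl' := ltnW hl.
  (* Indices in the unreversed rows: [dl l] steps before the end of row [l], and [dl l] steps after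
     the start of row [l + 1]. *)
  exists (k l - (dl l).+1), (dl l); rewrite !size_config_row; split; try lia.
  + by rewrite nth_config_row; [congr X; lia|lia].
  + by rewrite nth_config_row; [congr X; lia|lia].
  rewrite -nth_last -nth0 !nth_config_row ?size_config_row; try lia.
  have -> : k l - (k l).-1.+1 = 0 by lia.
  have [_ ->] := @row_dist l 0 (dl l) hl' isT d1.
  have [_ ->] := @row_dist l.+1 (k l.+1 - 1 - dl l) (k l.+1 - 1) hl
    ltac:(lia) ltac:(lia).
  by lia.
move=> x y; have [p hp ->] := sur x; have [q hq ->] := sur y.
move=> /(ed _ _ hp hq)[] h /negP nh.
  have [//|[l hl hlk]] := key _ _ hp hq h.
  by exists l; rewrite ?size_mkseq // !nth_mkseq ?(ltnW hl) //; left.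
have [h'|[l hl hlk]] := key _ _ hq hp h.
  by case: nh; apply: sub_has h' => P; rewrite /path_edge orbC.
by exists l; rewrite ?size_mkseq // !nth_mkseq ?(ltnW hl) //; right.
Qed.
End RowsToConfiguration.

(** Converse of [rows_shape]: cut the arms into rows of lengths [d1] and [d2], the inner bridge into
    rows of length [d + 1]. The strict bounds place both branch vertices inside their rows. *)
Lemma hnumbering_bridge_path (T : finType) (e : rel T) (q1 m q2 d1 d d2 : nat) X :
  0 < q1 -> 0 < q2 -> 0 < d -> d.+1 < d1 -> d.+1 < d2 ->
  hnumbering e (q1 * d1) (m * d.+1) (q2 * d2) (q1.-1 * d1 + d) (d2 - 1 - d) X ->
  path_like_with_bridge_path e.
Proof.
move=> q1P q2P dP d1P d2P hX.
pose n := q1 + m + q2.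
pose k l := if l < q1 then d1 else if l < q1 + m then d.+1 else d2.
(* Links within an arm join row ends; those touching the bridge, or joining the arms directly when
   [m = 0], use distance [d]. *)
pose dl l := if l.+1 < q1 then d1 - 1 else if l.+1 <= q1 + m then d else d2 - 1.
pose off := offset k.
have off0 : off 0 = 0 by exact: offset0.
have offS l : off l.+1 = off l + k l by exact: offsetS.
have kA l : l < q1 -> k l = d1 by rewrite /k => ->.
have kM l : q1 <= l < q1 + m -> k l = d.+1.
  by rewrite /k => hl; do 2?case: ifP => ?; lia.
have kB l : q1 + m <= l < q1 + m + q2 -> k l = d2.
  by rewrite /k => hl; do 2?case: ifP => ?; lia.
have RE p q : rowedge n k off dl p q <->
    hedge (q1 * d1) (m * d.+1) (q2 * d2) (q1.-1 * d1 + d) (d2 - 1 - d) p q.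
  by apply: rowedge_hedge => //; lia.
have oA l : l <= q1 -> off l = l * d1.
  by move=> hl; rewrite -[l]add0n (off_const offS (d := d1) (m := q1)) ?off0 //.
have o1 : off q1 = q1 * d1 by apply: oA.
have o2 : off (q1 + m) = q1 * d1 + m * d.+1.
  by rewrite -o1; apply: (off_const offS) kM _ _.
have o3 : off n = q1 * d1 + m * d.+1 + q2 * d2.
  by rewrite -o2; apply: (off_const offS) kB _ _.
have o0 : off q1.-1 = q1.-1 * d1 by apply: oA; lia.
have sE : q1 * d1 = q1.-1 * d1 + d1 by rewrite -{1}(prednK q1P) mulSn addnC.
have tE : q2 * d2 = q2.-1 * d2 + d2 by rewrite -{1}(prednK q2P) mulSn addnC.
have hi : 0 < q1.-1 * d1 + d < q1 * d1 - 1 by lia.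
have hj : 0 < d2 - 1 - d < q2 * d2 - 1 by lia.
have [si tj] : q1.-1 * d1 + d < q1 * d1 /\ d2 - 1 - d < q2 * d2 by lia.
have treee := hnumbering_treelike si tj hX.
have rX : numbering e (off n) (rowedge n k off dl) X.
  case: (hX) => inj sur ed; rewrite o3; split=> // p q hp hq.
  by rewrite ed // !RE.
have dlP l : l.+1 < n -> [/\ 0 < dl l, dl l < k l & dl l < k l.+1].
  by rewrite /dl /k /n => hl; do !case: ifP => ?; split; lia.
have kP l : l < n -> 0 < k l by rewrite /k => _; do !case: ifP => ?; lia.
have lcC := rows_linear_configuration off0 offS kP dlP rX treee.
have [inj sur ed] := rX.
have n1 : q1.-1.+1 < n by rewrite /n; lia.
have nM : (q1 + m).-1.+1 < n by rewrite /n; lia.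
have pos_lt l c : l < n -> c < k l -> off l + c < off n.
  by move=> hl hc; have := off_mono offS hl; rewrite offS; lia.
have link l : l.+1 < n -> e (X (off l + dl l)) (X (off l.+1 + (k l.+1 - 1 - dl l))).
  move=> hl; have [? ? ?] := dlP l hl.
  by apply/ed; [apply: pos_lt; lia|apply: pos_lt; lia|left; right; exists l].
have w1E : q1.-1 * d1 + d = off q1.-1 + dl q1.-1.
  by rewrite o0 /dl prednK // ltnn leq_addr.
have w2E : q1 * d1 + m * d.+1 + (d2 - 1 - d) =
    off (q1 + m).-1.+1 + (k (q1 + m).-1.+1 - 1 - dl (q1 + m).-1).
  have E : (q1 + m).-1.+1 = q1 + m by lia.
  rewrite E o2 kB ?/dl ?E ?leqnn; last lia.
  by case: ifP => ?; lia.
have [? dk1 dk2] := dlP _ n1; have [? dm1 dm2] := dlP _ nM.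
(* The branch vertices lie in rows [q1 - 1] and [q1 + m], which are [m + 1] apart. *)
exists (mkseq (config_row k off X) n), q1.-1, m.+1,
  (X (q1.-1 * d1 + d)), (X (q1 * d1 + m * d.+1 + (d2 - 1 - d))).
have lmE : q1.-1 + m.+1 = (q1 + m).-1.+1 by lia.
have lmE1 : q1.-1 + m.+1 - 1 = (q1 + m).-1 by lia.
rewrite lmE1 lmE addn1 size_mkseq; split=> //; split.
- by [].
- split; first by apply/eqP=> /inj E; have := E _ _; rewrite o3; lia.
  apply/setP=> x; rewrite !inE; have [p hp ->] := sur x.
  apply/eqP/orP => [deg|[]/eqP->].
  + rewrite o3 in hp; have [|[-> _]|[-> _]] := hnumbering_branch si tj hX hp.
    * by rewrite deg.
    * by left.
    * by right.
  + exact: hnumbering_degreeA hX hi.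
  + exact: hnumbering_degreeB hX hj.
- by rewrite !nth_mkseq // ?w1E ?w2E; [split; apply: mem_config_row; lia|lia].
- exists (X (off q1.-1.+1 + (k q1.-1.+1 - 1 - dl q1.-1))); last by rewrite w1E; apply: link.
  by rewrite nth_mkseq //; apply: mem_config_row; lia.
- exists (X (off (q1 + m).-1 + dl (q1 + m).-1)).
    by rewrite nth_mkseq; [apply: mem_config_row; lia|lia].
  by case: treee => sym _ _ _ _; rewrite w2E sym; apply: link.
Qed.

(** * Arithmetic of the parameters *)

(** [d] is the row length on the arm, and [d - delta] the distance from the branch vertex to one of
    the arm ends. *)
Definition arm_condition (s a delta : nat) : Prop :=
  exists2 d, d %| s & delta < d /\ (d - delta = a - 1 \/ d - delta = s - a).

Lemma arm_condition_end s a delta : 1 < a < s ->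
  delta \in [:: a; s - a + 1] -> arm_condition s a delta.
Proof. by rewrite !inE => ha hd; exists s => //; lia. Qed.

(** The minimum is positive, so the truncated difference forces [delta < d]. *)
Lemma arm_condition_min s a delta d : 1 < a < s ->
  d %| s -> d - delta = minn (a - 1) (s - a) -> arm_condition s a delta.
Proof. by move=> ha ds hd; exists d => //; lia. Qed.

(** If [d = s], solving for [delta] gives [a] or [s - a + 1]. Otherwise [d] is at most half of [s],
    and as [a - 1] and [s - a] add up to [s - 1], the value [d - delta] is the smaller of the
    two. *)
Lemma arm_conditionE s a delta : 1 < a < s -> 2 <= delta ->
  arm_condition s a delta -> delta \in [:: a; s - a + 1] \/
  exists d, [/\ d %| s, delta < d & d - delta = minn (a - 1) (s - a)].
Proof.
move=> ha h2 [d ds [hd E]]; rewrite !inE; case/dvdnP: (ds) => q sE.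
case: q sE => [|[|q]] sE; first by lia.
  by left; lia.
by right; exists d; split=> //; rewrite !mulSn in sE; lia.
Qed.

(** The four cases combine the two alternatives of [arm_conditionE] on each arm. In the last three,
    [2 <= delta] follows from the bounds on [a] and [b]. *)
Lemma conditions_arms s t r a b : 1 < a < s -> 1 < b < t ->
  [\/ (exists d1 d2 delta : nat,
         [/\ d1 %| s /\ d2 %| t,
             2 <= delta <= minn d1 d2 - 1,
             d1 - delta = minn (a - 1) (s - a),
             d2 - delta = minn (b - 1) (t - b)
           & delta %| r - 1]),
      (exists delta : nat,
         [/\ delta \in [:: a; s - a + 1],
             delta \in [:: b; t - b + 1]
           & delta %| r - 1]),
      (exists delta d2 : nat,
         [/\ delta \in [:: a; s - a + 1],
             d2 %| t,
             d2 - delta = minn (b - 1) (t - b)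
           & delta %| r - 1])
    | (exists delta d1 : nat,
         [/\ delta \in [:: b; t - b + 1],
             d1 %| s,
             d1 - delta = minn (a - 1) (s - a)
           & delta %| r - 1])]
  <-> exists delta, [/\ 2 <= delta, arm_condition s a delta,
        arm_condition t b delta & delta %| r - 1].
Proof.
move=> ha hb; split.
  case=> [[d1 [d2 [delta [[ds dt] hd E1 E2 dr]]]]|[delta [h1 h2 dr]]
         |[delta [d2 [h1 dt E2 dr]]]|[delta [d1 [h1 ds E1 dr]]]]; exists delta.
  - by split; [lia|exact: arm_condition_min ds E1|exact: arm_condition_min dt E2|].
  - by split; rewrite ?arm_condition_end //; [move: h1; rewrite !inE; lia| |];
      apply: arm_condition_end.
  - by split=> //; [move: h1; rewrite !inE; lia|apply: arm_condition_end|
      exact: arm_condition_min dt E2].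
  - by split=> //; [move: h1; rewrite !inE; lia|exact: arm_condition_min ds E1|
      apply: arm_condition_end].
case=> delta [h2 /(arm_conditionE ha h2) hs /(arm_conditionE hb h2) ht dr].
case: hs => [h1|[d1 [ds hd1 E1]]]; case: ht => [h1'|[d2 [dt hd2 E2]]].
- by constructor 2; exists delta.
- by constructor 3; exists delta, d2.
- by constructor 4; exists delta, d1.
- by constructor 1; exists d1, d2, delta; split=> //; clear -h2 hd1 hd2; lia.
Qed.

(** * The two implications *)

Lemma bridge_path_arms (T : finType) (e : rel T) (s t r a b : nat) :
  1 <= r -> 1 < a < s -> 1 < b < t -> is_type_H e s t r a b ->
  path_like_with_bridge_path e ->
  exists delta, [/\ 2 <= delta, arm_condition s a delta,
    arm_condition t b delta & delta %| r - 1].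
Proof.
move=> hr ha hb /(type_H_numbering hr ha hb)[X hX].
have [hi hj] : 0 < a - 1 < s - 1 /\ 0 < b - 1 < t - 1 by lia.
have [si tj] : a - 1 < s /\ b - 1 < t by lia.
have treee := hnumbering_treelike si tj hX.
have deg3 := hnumbering_degree_le3 si tj hX.
case=> C [l [m [w1 [w2 [lcC [[m1 lm] [_ D] [r1 r2] [x x_in ex] [y y_in ey]]]]]]].
have branch z : 2 < degree e z -> z = w1 \/ z = w2.
  move=> hz; have : z \in [set x | degree e x == 3] by rewrite inE eqn_leq deg3.
  by rewrite D !inE => /orP[]/eqP; [left|right].
have C1 : 1 < size C by lia.
have [k [off [dl [Y [off0 offS dlP hY coord]]]]] := configuration_numbering w1 treee lcC C1.
have [|c1 hc1 w1E] := coord l w1 _ r1; first by lia.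
have [c2 hc2 w2E] := coord _ w2 lm r2.
have [|c1' hc1' xE] := coord _ x _ x_in; first by lia.
have [|c2' hc2' yE] := coord _ y _ y_in; first by lia.
rewrite addn1 in hc1' xE; rewrite xE in ex; rewrite yE in ey.
have [q1 [m' [q2 [d1 [d [d2 [[q1P q2P] dP [dd1 dd2] hY']]]]]]] :=
  rows_shape off0 offS dlP hY deg3 m1 lm branch w1E hc1 hc1' ex w2E hc2 hc2' ey.
have sE : q1 * d1 = q1.-1 * d1 + d1 by rewrite -{1}(prednK q1P) mulSn addnC.
have tE : q2 * d2 = q2.-1 * d2 + d2 by rewrite -{1}(prednK q2P) mulSn addnC.
(* The numbering read off the configuration is compared with the given one. The arms may be
   exchanged, so [armA] and [armB] are stated for either arm. *)
have [||gE arms] := hnumbering_params hi hj _ _ hX hY'; try lia.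
have armA s' a' : 1 < a' < s' -> same_arm s' (a' - 1) (q1 * d1) (q1.-1 * d1 + d) ->
    arm_condition s' a' d.+1.
  move=> ha' [E0 E]; exists d1; first by rewrite -E0 dvdn_mull.
  by rewrite sE in E0; clear -ha' E0 E dd1; lia.
have armB s' a' : 1 < a' < s' -> same_arm s' (a' - 1) (q2 * d2) (d2 - 1 - d) ->
    arm_condition s' a' d.+1.
  move=> ha' [E0 E]; exists d2; first by rewrite -E0 dvdn_mull.
  by rewrite tE in E0; clear -ha' E0 E dd2; lia.
exists d.+1; rewrite gE dvdn_mull //; split=> //.
- by case: arms => -[h1 h2]; [apply: armA|apply: armB].
- by case: arms => -[h1 h2]; [apply: armB|apply: armA].
Qed.

Lemma arms_bridge_path (T : finType) (e : rel T) (s t r a b delta : nat) :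
  1 <= r -> 1 < a < s -> 1 < b < t -> is_type_H e s t r a b ->
  2 <= delta -> arm_condition s a delta -> arm_condition t b delta ->
  delta %| r - 1 -> path_like_with_bridge_path e.
Proof.
move=> hr ha hb /(type_H_numbering hr ha hb)[X hX] h2.
case=> d1 ds [hd1 E1] [d2 dt [hd2 E2]] /dvdnP[m gE].
have [si tj] : a - 1 < s /\ b - 1 < t by lia.
(* Reversing the arm if necessary puts the branch vertex at distance [d1 - delta] from the last
   position of the first arm, hence [delta - 1] into its last row. *)
have {hX} [X1 hX1] : exists X1, hnumbering e s (r - 1) t (s - 1 - (d1 - delta)) (b - 1) X1.
  case: E1 => ->; last first.
    by have -> : s - 1 - (s - a) = a - 1; [lia|exists X].
  exact: hnumbering_revl hX.
have {hX1} [X2 hX2] : exists X2, hnumbering e s (r - 1) t (s - 1 - (d1 - delta)) (d2 - delta) X2.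
  case: E2 => ->; first by exists X1.
  have -> : t - b = t - 1 - (b - 1) by lia.
  by apply: hnumbering_revr hX1; lia.
case/dvdnP: ds => q1 sE; case/dvdnP: dt => q2 tE.
have q1P : 0 < q1 by case: q1 sE => //; lia.
have q2P : 0 < q2 by case: q2 tE => //; lia.
have sE' : q1 * d1 = q1.-1 * d1 + d1 by rewrite -{1}(prednK q1P) mulSn addnC.
apply: (@hnumbering_bridge_path _ _ q1 m q2 d1 delta.-1 d2 X2); try lia.
rewrite prednK; last lia.
rewrite -sE -tE -gE; have -> : q1.-1 * d1 + delta.-1 = s - 1 - (d1 - delta) by lia.
by have -> : d2 - 1 - delta.-1 = d2 - delta by lia.
Qed.

Theorem theorem3 (T : finType) (e : rel T) (s t r a b : nat)
  (hr : 1 <= r) (ha : 1 < a < s) (hb : 1 < b < t)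
  (hT : is_type_H e s t r a b) :
  path_like_with_bridge_path e <->
  [\/ (exists d1 d2 delta : nat,
         [/\ d1 %| s /\ d2 %| t,
             2 <= delta <= minn d1 d2 - 1,
             d1 - delta = minn (a - 1) (s - a),
             d2 - delta = minn (b - 1) (t - b)
           & delta %| r - 1]),
      (exists delta : nat,
         [/\ delta \in [:: a; s - a + 1],
             delta \in [:: b; t - b + 1]
           & delta %| r - 1]),
      (exists delta d2 : nat,
         [/\ delta \in [:: a; s - a + 1],
             d2 %| t,
             d2 - delta = minn (b - 1) (t - b)
           & delta %| r - 1])
    | (exists delta d1 : nat,
         [/\ delta \in [:: b; t - b + 1],
             d1 %| s,
             d1 - delta = minn (a - 1) (s - a)
           & delta %| r - 1])].
Proof.
rewrite conditions_arms //; split; first exact: bridge_path_arms hT.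
by case=> delta [h2 hs ht dr]; apply: arms_bridge_path hT h2 hs ht dr.
Qed.
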